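(* For every integer $n\ge 0$, $$\mathscr A_{4,n}\in \mathfrak Z_{n+4}(1).$$
   Context: For real $x>0$ put $\binom{2x}{x}:=\frac{\Gamma(2x+1)}{[\Gamma(x+1)]^2}$. For integers $s\ge1$, $n\ge0$ define $$\mathscr A_{s,n}:=\sum_{k=1}^\infty\left.\frac{\partial^n}{\partial x^n}\frac{1}{x^s\binom{2x}{x}}\right|_{x=k}.$$ For a positive integer $w$, let $\mathfrak Z_w(1)\subset\mathbb R$ be the $\mathbb Q$-linear span of all multiple zeta values of weight $w$, i.e. of all numbers $$\zeta_{a_1,\dots,a_m}:=\sum_{\ell_1>\dots>\ell_m>0}\prod_{j=1}^m\frac{1}{\ell_j^{a_j}}$$ with $m\ge1$, $a_1,\dots,a_m$ positive integers, $\sum_j a_j=w$ and $a_1\ge2$. *)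

(* Defs.v *)
From HB Require Import structures.
From mathcomp Require Import all_boot all_order all_algebra.
From mathcomp Require Import all_classical all_reals all_analysis.
Import Order.TTheory GRing.Theory Num.Theory.
Import numFieldNormedType.Exports.

Set Implicit Arguments.
Unset Strict Implicit.
Unset Printing Implicit Defensive.

Local Open Scope classical_set_scope.
Local Open Scope ring_scope.

(* Euler's integral; it converges exactly for z > 0, which covers every use
   below. *)
Definition Gamma (R : realType) (z : R) : R :=
  \int[@lebesgue_measure R]_(t in `]0, +oo[) (t `^ (z - 1) * expR (- t)).

Definition central_binomial (R : realType) (x : R) : R :=
  Gamma (2 * x + 1) / Gamma (x + 1) ^+ 2.

Definition binom_summand (R : realType) (s : nat) (x : R) : R :=
  (x ^+ s * central_binomial x)^-1.

(* The index k of the series is shifted by one, since series start at 0. *)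
Definition inv_binom_sum (R : realType) (s n : nat) : R :=
  limn (series (fun k : nat => derive1n n (binom_summand s) (k.+1%:R : R))).

Definition mzv_index (m : nat) : set (m.-tuple nat) :=
  [set l | (forall i, 0 < tnth l i)%N /\
           (forall i j : 'I_m, (i < j)%N -> (tnth l j < tnth l i)%N)].

(* The terms are nonnegative, so the sum over all index tuples is a supremum
   of finite sums; it is finite whenever [mzv_admissible a]. *)
Definition mzv (R : realType) (a : seq nat) : R :=
  fine (\esum_(l in @mzv_index (size a))
          (\prod_(j < size a) ((tnth l j)%:R ^+ nth 0%N a j)^-1)%:E).

(* The default 0 of [head] makes [2 <= head 0 a] exclude the empty sequence. *)
Definition mzv_admissible (a : seq nat) : bool :=
  all (fun i => 0 < i)%N a && (2 <= head 0 a)%N.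

Definition mzv_span (R : realType) (w : nat) : set R :=
  [set x | exists c : seq (rat * seq nat),
     (forall p, p \in c -> mzv_admissible p.2 /\ sumn p.2 = w) /\
     x = \sum_(p <- c) ratr p.1 * mzv R p.2].

(* Main.v *)
(* Write p_m = m + a and f(k + a) = 1/((k + a)^4 binom(2k + 2a, k + a)), and
   let B be Euler's beta function, b_k(m) = B(p_m, p_k + 1), so that
   f(k + a) = p_k^-3 b_k(k).  For F defined on the integers put
   (I_s F)(m) = sum_(m' > m) p_m'^-s F(m').  The two relations
   B(p, q) = B(p, q + 1) + B(p + 1, q) and q B(p + 1, q) = p B(p, q + 1) give
   I_(s+1) b_(k-1) = I_(s+1) b_k + p_k^-1 I_s b_k, from which
     D_k = ((I_2 I_1 - 2 I_1 I_2 + 2 I_3 + 2 I_1 I_1 I_1) b_k)(k)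
   satisfies D_(k-1) - D_k = 9 f(k + a).  As D_k tends to 0, the sum of the
   f(k + a) over k >= 1 is D_0 / 9.  Finally
     B(m + a, 1 + a) = p_m^-1 prod_(j <= m) (1 + a/j)^-1
                              prod_(j > m) (1 + 2a/j) / (1 + a/j)^2,
   and since (1 + 2X)/(1 + X)^2 has no linear term, expanding D_0 in powers of a
   produces convergent nested sums, homogeneous of the right weight, that is,
   multiple zeta values.  All identities are between formal power series in a;
   the Gamma function only enters through the infinite product for
   Gamma(1 + a)^2 / Gamma(1 + 2a), i.e. the case m = 0 of the tail product. *)
From HB Require Import structures.
Require Import Defs.
From mathcomp Require Import all_boot all_order all_algebra.
From mathcomp Require Import all_classical all_reals all_analysis.
From mathcomp Require Import measurable_realfun.
From mathcomp Require Import ring lra zify.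
Import Order.TTheory GRing.Theory Num.Theory.
Import numFieldNormedType.Exports.

Set Implicit Arguments.
Unset Strict Implicit.
Unset Printing Implicit Defensive.

Local Open Scope classical_set_scope.
Local Open Scope ring_scope.

(** Formal series remove every exchange of limits: the [n]-th derivative of a summand is [n!] times
    one coefficient of a series, and the sum over k telescopes in that degree alone. What remains
    are estimates uniform in the indices. Coefficients of Beta values carry powers of logarithms, so
    they are all compared with (m + 1)^(-1/2): dividing by m and summing over a tail reproduces this
    weight up to a constant, which settles iterated tails once and for all. Products with a growing
    number of factors are controlled by the norm sum |u_i| 16^-i, in which a linear factor acts as a
    number. The radius 1/16 lies inside the disc |a| < 1/8 where the coefficient bounds of the tail
    product give convergence. It is also small enough for the Beta values to stay O(m^(-1/2)) and
    the product of the 1 + a/j to stay O(m^(1/4)), so that their product still tends to 0.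
    Identities between nested sums are proved without rearranging: both sides satisfy the same first
    order recursion in m and tend to 0. *)

Definition fps (R : realType) : Type := nat -> R.

(** * Formal power series as a commutative ring *)

Section FpsRing.
Variable R : realType.
Implicit Types u v w : fps R.

HB.instance Definition _ := Choice.copy (fps R) (nat -> R).

Definition fps_add u v : fps R := fun e => u e + v e.
Definition fps_opp u : fps R := fun e => - u e.
Definition fps_const (c : R) : fps R := fun e => if e is 0%N then c else 0.

Lemma fps_addA : associative fps_add.
Proof. by move=> u v w; apply/funext => e; exact: addrA. Qed.
Lemma fps_addC : commutative fps_add.
Proof. by move=> u v; apply/funext => e; exact: addrC. Qed.
Lemma fps_add0 : left_id (fps_const 0) fps_add.
Proof. by move=> u; apply/funext => -[|e]; exact: add0r. Qed.
Lemma fps_addN : left_inverse (fps_const 0) fps_opp fps_add.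
Proof. by move=> u; apply/funext => -[|e]; exact: addNr. Qed.

HB.instance Definition _ :=
  GRing.isZmodule.Build (fps R) fps_addA fps_addC fps_add0 fps_addN.

Definition fps_mul u v : fps R := fun e => \sum_(i < e.+1) u i * v (e - i)%N.

(** Commutativity and associativity are borrowed from polynomials, because the coefficient of degree
    [e] of a product only sees the factors up to degree [e]. *)
Let trunc n u : {poly R} := \poly_(i < n.+1) u i.

Let fps_mul_trunc n e u v :
  (e <= n)%N -> fps_mul u v e = (trunc n u * trunc n v)`_e.
Proof.
move=> en; rewrite coefM; apply: eq_bigr => i _; rewrite !coef_poly.
have ie : (i < n.+1)%N by exact: leq_trans (ltn_ord i) _.
by rewrite ie ltnS (leq_trans (leq_subr _ _)).
Qed.

Let trunc_coef n e u : (e <= n)%N -> (trunc n u)`_e = u e.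
Proof. by move=> en; rewrite coef_poly ltnS en. Qed.

Lemma fps_mulC : commutative fps_mul.
Proof.
by move=> u v; apply/funext => e; rewrite !(@fps_mul_trunc e)// mulrC.
Qed.

Lemma fps_mulA : associative fps_mul.
Proof.
move=> u v w; apply/funext => e.
have eq1 (p q r : {poly R}) : (forall i, (i <= e)%N -> p`_i = q`_i) ->
    (p * r)`_e = (q * r)`_e.
  move=> pq; rewrite !coefM; apply: eq_bigr => i _.
  by rewrite pq// -ltnS.
rewrite !(@fps_mul_trunc e)// mulrC.
rewrite (eq1 (trunc e (fps_mul v w)) (trunc e v * trunc e w)); last first.
  by move=> i ie; rewrite trunc_coef// (@fps_mul_trunc e).
rewrite (eq1 (trunc e (fps_mul u v)) (trunc e u * trunc e v)); last first.
  by move=> i ie; rewrite trunc_coef// (@fps_mul_trunc e).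
by congr (nth 0 (polyseq _) e); ring.
Qed.

Lemma fps_mul1 : left_id (fps_const 1) fps_mul.
Proof.
move=> u; apply/funext => e; rewrite /fps_mul big_ord_recl /= mul1r subn0.
by rewrite big1 ?addr0// => i _; rewrite mul0r.
Qed.

Lemma fps_mulDl : left_distributive fps_mul fps_add.
Proof.
move=> u v w; apply/funext => e; rewrite /fps_add /fps_mul -big_split /=.
by apply: eq_bigr => i _; rewrite mulrDl.
Qed.

Lemma fps_oner_neq0 : fps_const 1 != 0.
Proof.
by apply/eqP => /(congr1 (fun u : fps R => u 0%N)) /eqP; rewrite oner_eq0.
Qed.

HB.instance Definition _ := GRing.Zmodule_isComNzRing.Build (fps R)
  fps_mulA fps_mulC fps_mul1 fps_mulDl fps_oner_neq0.

Lemma fpsD u v e : (u + v) e = u e + v e. Proof. by []. Qed.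
Lemma fpsN u e : (- u) e = - u e. Proof. by []. Qed.
Lemma fps0 e : (0 : fps R) e = 0. Proof. by case: e. Qed.
Lemma fps1 e : (1 : fps R) e = (e == 0%N)%:R. Proof. by case: e. Qed.
Lemma fpsM u v e : (u * v) e = \sum_(i < e.+1) u i * v (e - i)%N.
Proof. by []. Qed.
Lemma fpsMn u n e : (u *+ n) e = u e *+ n.
Proof. by elim: n => [|n IH]; rewrite ?mulr0n ?fps0// !mulrS fpsD IH. Qed.

End FpsRing.

(** * Tails of series whose terms are O(m^(-3/2)) *)

Section Tails.
Variable R : realType.
Implicit Types (g psi : nat -> R) (C : R).

Definition wt (m : nat) : R := (Num.sqrt m.+1%:R)^-1.

Lemma wt_gt0 m : 0 < wt m.
Proof. by rewrite invr_gt0 sqrtr_gt0 ltr0n. Qed.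

Lemma wt_le m n : (m <= n)%N -> wt n <= wt m.
Proof.
move=> mn; rewrite /wt lef_pV2 ?posrE ?sqrtr_gt0 ?ltr0n//.
by rewrite ler_sqrt ?ler0n// ler_nat ltnS.
Qed.

Lemma wt_le1 m : wt m <= 1.
Proof. by rewrite (le_trans (wt_le (leq0n m)))// /wt sqrtr1 invr1. Qed.

(** With x = sqrt(m + 1) and y = sqrt(m + 2), the difference of weights is 1 / (x y (x + y)), so the
    claim reduces to x + y <= 4 x, and y <= 2 x suffices. *)
Lemma wt_telescope m : wt m.+1 / m.+1%:R <= 4 * (wt m - wt m.+1).
Proof.
rewrite /wt; have xx : m.+1%:R = Num.sqrt m.+1%:R ^+ 2 :> R by rewrite sqr_sqrtr ?ler0n.
have yy : Num.sqrt m.+2%:R ^+ 2 = Num.sqrt m.+1%:R ^+ 2 + 1 :> R.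
  by rewrite -xx natr1 sqr_sqrtr ?ler0n.
have x0 : 0 < Num.sqrt m.+1%:R :> R by rewrite sqrtr_gt0 ltr0n.
have y0 : 0 < Num.sqrt m.+2%:R :> R by rewrite sqrtr_gt0 ltr0n.
have x1 : 1 <= Num.sqrt m.+1%:R :> R by rewrite -[leLHS]sqrtr1 ler_sqrt ?ler0n// ler1n.
have xy : Num.sqrt m.+1%:R <= Num.sqrt m.+2%:R :> R by rewrite ler_sqrt ?ler0n// ler_nat.
rewrite [X in _ / X <= _]xx.
move: yy x0 y0 x1 xy; move: (Num.sqrt _) (Num.sqrt _) => x y yy x0 y0 x1 xy.
rewrite -subr_ge0.
have -> : 4 * (x^-1 - y^-1) - y^-1 / x ^+ 2 = (4 * x * (y - x) - 1) / (x ^+ 2 * y).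
  by field; rewrite (gt_eqF x0) (gt_eqF y0).
apply: divr_ge0; last by rewrite mulr_ge0 ?sqr_ge0 ?(ltW y0).
have y2x : y <= 2 * x.
  have x20 : 0 <= 2 * x by rewrite mulr_ge0 ?(ltW x0).
  rewrite -ler_sqr ?nnegrE ?(ltW y0)//.
  by rewrite exprMn yy; have := exprn_ege1 2 x1; lra.
have E : (y - x) * (y + x) = 1 by rewrite (_ : _ * _ = y ^+ 2 - x ^+ 2); [rewrite yy; ring|ring].
have yx0 : 0 <= y - x by rewrite subr_ge0.
have xy0 : 0 <= 4 * x - (y + x) by lra.
by have := mulr_ge0 yx0 xy0; rewrite mulrBr E; lra.
Qed.

Lemma wt_cvg0 : wt @ \oo --> 0.
Proof.
apply/cvgr0Pnorm_le => e e0; near=> n.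
have e1 : 0 < e^-1 by rewrite invr_gt0.
rewrite ger0_norm ?(ltW (wt_gt0 _))// /wt -[leRHS]invrK.
rewrite lef_pV2 ?posrE ?sqrtr_gt0 ?ltr0n//.
rewrite -(ger0_norm (ltW e1)) -sqrtr_sqr ler_sqrt ?ler0n//.
rewrite (@le_trans _ _ n%:R) ?ler_nat//.
by near: n; exact: nbhs_infty_ger.
Unshelve. all: by end_near. Qed.

(** Only positive indices are constrained, because terms divided by a power of m have a merely
    conventional value at 0. *)
Definition dominated C g := forall m, `|g m.+1| <= C * (wt m.+1 / m.+1%:R).

Definition tail g n : R := limn (series (fun i => g (n + i).+1)).

(** A null sequence is the tail of its own differences. Two expressions in m are therefore equal as
    soon as both are null and have the same differences. *)
Lemma tail_telescope g psi n : (forall m, psi m - psi m.+1 = g m.+1) ->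
  psi @ \oo --> 0 -> tail g n = psi n.
Proof.
move=> H p0; apply: cvg_lim => //.
have -> : series (fun i => g (n + i).+1) = fun N => psi n - psi (N + n)%N.
  apply/funext; elim=> [|N IH]; first by rewrite /series/= big_geq// subrr.
  by rewrite seriesSr IH -H addSn (addnC n); ring.
rewrite -[X in _ --> X]subr0; apply: cvgB; first exact: cvg_cst.
by rewrite (cvg_shiftn n psi).
Qed.

Section Dominated.
Variables (C : R) (g : nat -> R).
Hypothesis domg : dominated C g.

Lemma dominated_ge0 : 0 <= C.
Proof.
have := domg 0; move/(le_trans (normr_ge0 _)).
by rewrite pmulr_lge0// divr_gt0// wt_gt0.
Qed.

Let bound n N : series (fun i => `|g (n + i).+1|) N <= 4 * C * (wt n - wt (n + N)%N).
Proof.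
elim: N => [|N IH]; first by rewrite /series/= big_geq// addn0 subrr mulr0.
rewrite seriesSr addnS; apply: le_trans (lerD IH (domg _)) _.
have H := ler_wpM2l dominated_ge0 (wt_telescope (n + N)).
by apply: le_trans (lerD (lexx _) H) _; rewrite -subr_ge0 le_eqVlt; apply/orP; left; apply/eqP; ring.
Qed.

Lemma tail_cvg n : series (fun i => g (n + i).+1) @ \oo --> tail g n.
Proof.
suff H : cvgn (series (fun i => `|g (n + i).+1|)) by exact: normed_cvg H.
apply: nondecreasing_is_cvgn; first by apply: nondecreasing_series => i _ _.
exists (4 * C * wt n) => _ [N _ <-]; apply: le_trans (bound n N) _.
by rewrite ler_wpM2l ?mulr_ge0 ?dominated_ge0// gerBl ltW// wt_gt0.
Qed.

Lemma tail_rec n : tail g n = g n.+1 + tail g n.+1.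
Proof.
apply: cvg_lim => //; rewrite -cvg_shiftS/=.
have -> : (fun N => series (fun i => g (n + i).+1) N.+1) =
    (fun N => g n.+1 + series (fun i => g (n.+1 + i).+1) N).
  apply/funext => N; rewrite /series/= big_nat_recl// addn0.
  by congr (_ + _); apply: eq_bigr => i _; rewrite addSnnS.
by apply: cvgD; [exact: cvg_cst|exact: tail_cvg].
Qed.

Lemma tail_le n : `|tail g n| <= 4 * C * wt n.
Proof.
have h : (fun N => `|series (fun i => g (n + i).+1) N|) @ \oo --> `|tail g n|.
  by apply: cvg_norm; exact: tail_cvg.
rewrite -(cvg_lim (@Rhausdorff R) h); apply: limr_le; first exact: (cvgP _ h).
near=> N; apply: le_trans (ler_norm_sum _ _ _) _.
apply: le_trans (bound n N) _.
by rewrite ler_wpM2l ?mulr_ge0 ?dominated_ge0// gerBl ltW// wt_gt0.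
Unshelve. all: by end_near. Qed.

Lemma tail_cvg0 : tail g @ \oo --> 0.
Proof.
apply: norm_cvg0.
have ub : (fun n => 4 * C * wt n) @ \oo --> 0.
  by rewrite -(mulr0 (4 * C)); apply: cvgMr; exact: wt_cvg0.
apply: (squeeze_cvgr _ (cvg_cst 0) ub).
by near=> n; rewrite normr_ge0 tail_le.
Unshelve. all: by end_near. Qed.

End Dominated.

End Tails.

(** * Nested zeta tails and multiple zeta values *)

Section ZetaTails.
Variable R : realType.
Implicit Types (s l : seq nat) (phi : nat -> R).

Lemma dominated_div phi C b : (0 < b)%N -> (forall m, `|phi m| <= C * wt R m) ->
  dominated C (fun m => phi m / m%:R ^+ b).
Proof.
move=> b0 H m; rewrite normrM normfV normrX [`|m.+1%:R|]ger0_norm// mulrA.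
apply: ler_pM; rewrite ?normr_ge0 ?invr_ge0 ?exprn_ge0//.
rewrite lef_pV2 ?posrE ?exprn_gt0 ?ltr0n//.
by rewrite -[leLHS]expr1 ler_weXn2l// ler1n.
Qed.

(** One of the two factors 1/m pays for the weight, as 1/m <= 2/(m + 1) <= 2 wt m. *)
Lemma dominated_div2 phi C b : (1 < b)%N -> (forall m, `|phi m| <= C) ->
  dominated (2 * C) (fun m => phi m / m%:R ^+ b).
Proof.
case: b => // b b0 H.
have C0 : 0 <= C := le_trans (normr_ge0 _) (H 0%N).
have -> : (fun m => phi m / m%:R ^+ b.+1) = (fun m => phi m / m%:R / m%:R ^+ b).
  by apply/funext => m; rewrite exprS invfM mulrA.
apply: (@dominated_div (fun m => phi m / m%:R) (2 * C) b) => // k.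
rewrite normrM normfV normr_nat; case: k => [|k].
  by rewrite invr0 mulr0 mulr_ge0 ?mulr_ge0// ltW// wt_gt0.
rewrite (mulrC 2) -mulrA; apply: ler_pM => //; rewrite ?invr_ge0//.
have K0 : 0 < k.+1%:R :> R by rewrite ltr0n.
have W : k.+2%:R^-1 <= wt R k.+1.
  rewrite lef_pV2 ?posrE ?sqrtr_gt0 ?ltr0n// -[leRHS]ger0_norm// -sqrtr_sqr.
  by rewrite ler_sqrt ?sqr_ge0// expr2 ler_peMr// ler1n.
apply: le_trans (ler_wpM2l _ W) => //.
rewrite -[leLHS]mul1r ler_pdivrMr// mulrAC ler_pdivlMr ?ltr0n// mul1r.
by rewrite -natrM ler_nat; lia.
Qed.

(* The exponents are listed from the innermost index outwards, i.e. in the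
   order opposite to that of [mzv], so that prepending an exponent prolongs the
   sum by a smaller summation index. *)
Fixpoint zeta_tail s (n : nat) : R :=
  if s is b :: s' then tail (fun m => zeta_tail s' m / m%:R ^+ b) n else 1.

Definition zeta_valid s := all (leq 1) s && (nilp s || (2 <= last 0 s)%N).

Lemma zeta_valid_behead b s : zeta_valid (b :: s) -> zeta_valid s.
Proof. by rewrite /zeta_valid /=; case: s => //= c s /andP[/andP[_ ->]]. Qed.

(** Only the largest index needs an exponent at least 2: every further sum starts from a tail of
    size [wt], for which a single factor 1/m is enough. *)
Lemma zeta_tail_dominated b s : zeta_valid (b :: s) ->
  exists C, dominated C (fun m => zeta_tail s m / m%:R ^+ b).
Proof.
elim: s b => [|c s IH] b v.
  exists (2 * 1); apply: dominated_div2; last by move=> m; rewrite normr1.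
  by move: v; rewrite /zeta_valid/= => /andP[].
have [C HC] := IH _ (zeta_valid_behead v); exists (4 * C).
apply: dominated_div; first by case/andP: v => /andP[].
by move=> m; apply: tail_le HC _.
Qed.

Lemma zeta_tail_ge0 s n : zeta_valid s -> 0 <= zeta_tail s n.
Proof.
elim: s n => [|b s IH] n v //=.
have [C HC] := zeta_tail_dominated v.
rewrite -(cvg_lim (@Rhausdorff R) (@tail_cvg R C _ HC n)).
apply: limr_ge; first exact: (cvgP _ (@tail_cvg R C _ HC n)).
apply: nearW => N; apply: sumr_ge0 => i _.
by rewrite divr_ge0 ?exprn_ge0 ?IH// (zeta_valid_behead v).
Qed.

Fixpoint zeta_monomial s l : R :=
  match s, l with
  | b :: s', m :: l' => (m%:R ^+ b)^-1 * zeta_monomial s' l'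
  | _, _ => 1
  end.

Definition increasing_above s n : set (seq nat) :=
  [set l | size l = size s /\ path ltn n l].

Lemma zeta_monomial_ge0 s l : 0 <= zeta_monomial s l.
Proof.
by elim: s l => [|b s IH] [|m l] //=; rewrite mulr_ge0 ?invr_ge0 ?exprn_ge0.
Qed.

(** The constant [c] serves the induction: it absorbs the factor of the smallest index once that
    index is fixed. *)
Lemma esum_zeta_monomial s n (c : R) : zeta_valid s -> 0 <= c ->
  (\esum_(l in increasing_above s n) (c * zeta_monomial s l)%:E)%E =
  (c * zeta_tail s n)%:E.
Proof.
elim: s n c => [|b s IH] n c v c0.
  rewrite (_ : increasing_above [::] n = [set [::]]).
    by rewrite esum_set1 ?lee_fin ?mulr_ge0//= mulr1.
  apply/seteqP; split => [l [/size0nil ->//]|l ->//].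
have [C HC] := zeta_tail_dominated v.
have v' := zeta_valid_behead v.
rewrite (@reindex_esum R _ _ ([set: nat] `*`` (fun i => increasing_above s (n + i).+1))
  _ (fun x => (n + x.1).+1 :: x.2)); last first.
  split.
  - move=> [i l] [_ [/= sl pl]]; split; rewrite /= ?sl//.
    by rewrite pl ltnS leq_addr.
  - move=> [i l] [j l'] _ _ /= [/addnI -> ->] //.
  - move=> [|m l] [//= [sl] /andP[nm pl]].
    exists ((m - n.+1)%N, l) => /=; last by congr (_ :: _); lia.
    split => //=; split => //; rewrite (_ : (n + (m - n.+1)).+1 = m)//; lia.
have ge0 i l : 0 <= c * zeta_monomial (b :: s) ((n + i).+1 :: l).
  by rewrite mulr_ge0// zeta_monomial_ge0.
rewrite -(@esum_esum R _ _ setT (fun i => increasing_above s (n + i).+1)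
  (fun i l => (c * zeta_monomial (b :: s) ((n + i).+1 :: l))%:E)); last first.
  by move=> i l _ _; rewrite lee_fin.
under eq_esum => i _.
  under eq_esum => l _ do rewrite /= mulrA.
  rewrite IH//; last by rewrite mulr_ge0// invr_ge0 exprn_ge0.
  over.
rewrite -nneseries_esumT; last first.
  move=> i; rewrite lee_fin mulr_ge0 ?zeta_tail_ge0//.
  by rewrite mulr_ge0// invr_ge0 exprn_ge0.
apply: cvg_lim => //.
rewrite (_ : (fun N => _) = EFin \o (fun N => c *
    series (fun i => zeta_tail s (n + i).+1 / (n + i).+1%:R ^+ b) N)).
  apply: cvg_EFin; first exact: nearW.
  by apply: cvgMr; exact: tail_cvg HC n.
apply/funext => N; rewrite /series/= sumEFin mulr_sumr; congr (_%:E).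
by apply: eq_bigr => i _; rewrite mulrAC mulrA.
Qed.

Lemma zeta_monomialE s l : size l = size s ->
  zeta_monomial s l =
    \prod_(0 <= j < size s) ((nth 0%N l j)%:R ^+ nth 0%N s j)^-1.
Proof.
elim: s l => [|b s IH] [|m l] //=; first by rewrite big_geq.
by move=> [sl]; rewrite IH// big_nat_recl.
Qed.

Lemma mzv_indexE n (t : n.-tuple nat) :
  mzv_index t <-> path ltn 0 (rev t).
Proof.
rewrite path_sortedE; last exact: ltn_trans.
rewrite all_rev rev_sorted sorted_pairwise; last by move=> y x z xy yz; exact: ltn_trans yz xy.
split=> [[t0 ti]|/andP[/allP t0 /(pairwiseP 0%N) ti]].
  apply/andP; split; first by apply/allP => _ /tnthP[i ->]; exact: t0.
  apply/(pairwiseP 0%N) => i j; rewrite !inE size_tuple => ilt jlt ij.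
  have := ti (Ordinal ilt) (Ordinal jlt) ij.
  by rewrite !(tnth_nth 0%N).
split=> [i|i j ij]; first by apply: t0; exact: mem_tnth.
by rewrite !(tnth_nth 0%N); apply: ti => //; rewrite inE size_tuple.
Qed.

Lemma mzvE (a : seq nat) : mzv_admissible a -> mzv R a = zeta_tail (rev a) 0.
Proof.
move=> adm; have v : zeta_valid (rev a).
  move: adm; rewrite /mzv_admissible /zeta_valid all_rev => /andP[-> h].
  by case: a h => //= b a b2; rewrite rev_cons last_rcons b2 orbT.
have := @esum_zeta_monomial (rev a) 0 1 v ler01.
rewrite mul1r => E; rewrite /mzv -[RHS]/(fine _%:E) -E; congr fine; symmetry.
rewrite (@reindex_esum R _ _ (@mzv_index (size a)) _ (fun t => rev (tval t))).
  apply: eq_esum => t _; congr (_%:E); rewrite mul1r.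
  rewrite zeta_monomialE ?size_rev ?size_tuple// big_nat_rev/= big_mkord.
  apply: eq_bigr => i _; have ia := ltn_ord i.
  rewrite add0n !nth_rev ?size_tuple; [|lia|lia].
  by rewrite (_ : (size a - _.+1)%N = i) ?(tnth_nth 0%N)//; lia.
split.
- by move=> t /mzv_indexE; split=> //; rewrite !size_rev size_tuple.
- by move=> t t' _ _ /(can_inj revK) /val_inj.
move=> l [sl pl]; have sl' : size (rev l) == size a by rewrite size_rev sl size_rev.
exists (Tuple sl'); last by rewrite /= revK.
by apply/mzv_indexE; rewrite /= revK.
Qed.

End ZetaTails.

(** * Rational combinations of nested tails *)

Section RationalSpans.
Variable R : realType.
Implicit Types (phi psi g : nat -> R) (s : seq nat).

(** The coefficients must not depend on [n]: membership concerns whole families, so that it can be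
    carried along recursions in [n], although only the value at 0 is wanted in the end. *)
Definition rat_span (P : pred (seq nat)) (F : seq nat -> nat -> R) phi :=
  exists c : seq (rat * seq nat), (forall p, p \in c -> P p.2) /\
    forall n, phi n = \sum_(p <- c) ratr p.1 * F p.2 n.

Section Closure.
Variables (P : pred (seq nat)) (F : seq nat -> nat -> R).

Lemma rat_span_ext phi psi : phi =1 psi -> rat_span P F phi -> rat_span P F psi.
Proof. by move=> e [c [Pc E]]; exists c; split=> // n; rewrite -e. Qed.

Lemma rat_span0 : rat_span P F (fun=> 0).
Proof. by exists [::]; split=> // n; rewrite big_nil. Qed.

Lemma rat_spanD phi psi : rat_span P F phi -> rat_span P F psi ->
  rat_span P F (fun n => phi n + psi n).
Proof.
move=> [c [Pc Ec]] [d [Pd Ed]]; exists (c ++ d); split=> [p|n].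
  by rewrite mem_cat => /orP[/Pc|/Pd].
by rewrite big_cat/= Ec Ed.
Qed.

Lemma rat_spanZ (q : rat) phi : rat_span P F phi ->
  rat_span P F (fun n => ratr q * phi n).
Proof.
move=> [c [Pc Ec]]; exists [seq (q * p.1, p.2) | p <- c]; split=> [_ /mapP[p pc ->]|n].
  exact: (Pc p).
by rewrite big_map Ec mulr_sumr; apply: eq_bigr => p _; rewrite rmorphM mulrA.
Qed.

Lemma rat_span_sum (I : eqType) (r : seq I) (G : I -> nat -> R) :
  (forall i, i \in r -> rat_span P F (G i)) ->
  rat_span P F (fun n => \sum_(i <- r) G i n).
Proof.
elim: r => [|i r IH] H.
  by apply: rat_span_ext rat_span0 => n; rewrite big_nil.
apply: (@rat_span_ext (fun n => G i n + \sum_(j <- r) G j n)).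
  by move=> n; rewrite big_cons.
apply: rat_spanD; first by apply: H; rewrite mem_head.
by apply: IH => j jr; apply: H; rewrite inE jr orbT.
Qed.

End Closure.

Definition tail_span w := rat_span (fun s => zeta_valid s && (sumn s == w))
  (@zeta_tail R).

(** These are the terms that [zeta_tail] loses from [m] to [m.+1]; the empty index is excluded
    because its tail is constant. *)
Definition summand_span w := rat_span
  (fun s => [&& ~~ nilp s, zeta_valid s & sumn s == w])
  (fun s m => zeta_tail R (behead s) m.+1 / m.+1%:R ^+ head 0%N s).

(** The condition [1 < w] is for the empty index in [phi], where [b] becomes the exponent of the
    largest index. *)
Lemma summand_span_div v b w phi : (0 < b)%N -> (v + b = w)%N -> (1 < w)%N ->
  tail_span v phi -> summand_span w (fun m => phi m.+1 / m.+1%:R ^+ b).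
Proof.
move=> b0 vb w1 [c [Pc Ec]]; exists [seq (p.1, b :: p.2) | p <- c].
split=> [_ /mapP[p pc ->]/=|m]; last first.
  by rewrite big_map Ec mulr_suml; apply: eq_bigr => p _; rewrite mulrA.
have /andP[/andP[ps pl] /eqP pv] := Pc _ pc.
rewrite pv addnC vb eqxx andbT /zeta_valid /= b0 ps/=.
case: p.2 pl pv => [|c0 s]//= _ v0.
by rewrite -v0 in vb; rewrite add0n in vb; rewrite vb.
Qed.

Lemma zeta_tail_cvg0 s : zeta_valid s -> ~~ nilp s -> zeta_tail R s @ \oo --> 0.
Proof.
case: s => // b s v _; have [C HC] := zeta_tail_dominated R v.
exact: tail_cvg0 HC.
Qed.

Lemma zeta_tail_rec b s m : zeta_valid (b :: s) ->
  zeta_tail R (b :: s) m =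
    zeta_tail R s m.+1 / m.+1%:R ^+ b + zeta_tail R (b :: s) m.+1.
Proof.
by move=> v; have [C HC] := zeta_tail_dominated R v; rewrite [LHS](tail_rec HC).
Qed.

Lemma cvg_sum0 (I : eqType) (r : seq I) (G : I -> nat -> R) :
  (forall i, i \in r -> G i @ \oo --> 0) ->
  (fun n => \sum_(i <- r) G i n) @ \oo --> 0.
Proof.
elim: r => [|i r IH] H.
  by under eq_fun do rewrite big_nil; exact: cvg_cst.
under eq_fun do rewrite big_cons.
have h1 := H i (mem_head _ _).
have h2 : (fun n => \sum_(j <- r) G j n) @ \oo --> 0.
  by apply: IH => j jr; apply: H; rewrite inE jr orbT.
by have := cvgD h1 h2; rewrite addr0; exact.
Qed.

(** The coefficients found for the differences serve for [psi] itself, since [psi] and the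
    corresponding combination of tails are null sequences with the same differences. *)
Lemma tail_span_telescope w psi g : summand_span w g ->
  (forall m, psi m - psi m.+1 = g m) -> psi @ \oo --> 0 -> tail_span w psi.
Proof.
move=> [c [Pc Ec]] Hpsi psi0; exists c; split=> [p /Pc/and3P[_ -> ->]//|n].
have <- : tail (g \o predn) n = psi n by exact: tail_telescope.
apply: (@tail_telescope _ _ (fun n => \sum_(p <- c) ratr p.1 * zeta_tail R p.2 n)).
  move=> m; rewrite /= Ec -sumrB; apply: eq_big_seq => p /Pc.
  case: p => q [|b s] /and3P[]//= _ v _.
  by rewrite -mulrBr; have /= -> := zeta_tail_rec m v; rewrite addrK.
apply: cvg_sum0 => p /Pc/and3P[p0 v _].
by rewrite -(mulr0 (ratr p.1)); apply: cvgMr; exact: zeta_tail_cvg0.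
Qed.

Lemma mzv_span_tail w phi : (0 < w)%N -> tail_span w phi -> mzv_span w (phi 0%N).
Proof.
move=> w0 [c [Pc Ec]]; exists [seq (p.1, rev p.2) | p <- c].
have adm p : p \in c -> mzv_admissible (rev p.2) /\ sumn (rev p.2) = w.
  move=> /Pc/andP[/andP[ps pl] /eqP pw]; rewrite sumn_rev pw; split=> //.
  rewrite /mzv_admissible all_rev ps/=; case/lastP: p.2 pl pw => [_ w0'|s b].
    by rewrite -w0' in w0.
  by rewrite rev_rcons/= last_rcons /nilp size_rcons.
split=> [_ /mapP[p /adm ? ->]//|].
rewrite big_map Ec; apply: eq_big_seq => p /adm[a _].
by rewrite mzvE// revK.
Qed.

End RationalSpans.

(** * The series c + d X ([lin]) and 1 / (c + d X) ([invlin]) *)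

Section LinearSeries.
Variable R : realType.
Implicit Types (c d : R) (u v : fps R).

Definition lin c d : fps R :=
  fun e => match e with 0%N => c | 1%N => d | _ => 0 end.

Definition invlin c d : fps R := fun e => (- d) ^+ e / c ^+ e.+1.

Lemma linM0 c d u : (lin c d * u) 0%N = c * u 0%N.
Proof. by rewrite fpsM big_ord1. Qed.

Lemma linMS c d u e : (lin c d * u) e.+1 = c * u e.+1 + d * u e.
Proof.
rewrite fpsM big_ord_recl big_ord_recl/= subn0 big1 ?addr0 ?subn1//.
by move=> i _; rewrite mul0r.
Qed.

Lemma lin_invlin c d : c != 0 -> lin c d * invlin c d = 1.
Proof.
move=> c0; apply/funext => -[|e].
  by rewrite linM0 /invlin expr0 expr1 mul1r divff.
rewrite linMS fps1 /invlin/= !exprS.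
by field; rewrite expf_neq0 ?c0.
Qed.

Lemma lin_const c : lin c 0 = fps_const c.
Proof. by apply/funext => -[|[|e]]. Qed.

Lemma lin1 : lin 1 0 = 1.
Proof. by rewrite lin_const. Qed.

Lemma linD c d c' d' : lin c d + lin c' d' = lin (c + c') (d + d').
Proof. by apply/funext => -[|[|e]]//; rewrite fpsD/= addr0. Qed.

Lemma linZ k c d : lin k 0 * lin c d = lin (k * c) (k * d).
Proof.
apply/funext => -[|e]; first by rewrite linM0.
by rewrite linMS mul0r addr0; case: e => [|e]//=; rewrite mulr0.
Qed.

End LinearSeries.

(** * Weight of the coefficients of a series *)

Section Graded.
Variable R : realType.
Implicit Types (u : nat -> fps R) (Phi chi : nat -> fps R).

(** Models expansions of rational functions of X and [m.+1] that are homogeneous of degree -b: each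
    power of X comes with one more power of 1 / m.+1. *)
Definition homogeneous (b : nat) u := exists q : nat -> rat,
  forall m e, u m e = ratr (q e) / m.+1%:R ^+ (e + b).

Lemma homogeneousM b b' u v : homogeneous b u -> homogeneous b' v ->
  homogeneous (b + b')%N (fun m => u m * v m).
Proof.
move=> [q Eq] [q' Eq'].
exists (fun e => \sum_(i < e.+1) q i * q' (e - i)%N) => m e.
rewrite fpsM rmorph_sum mulr_suml; apply: eq_bigr => i _.
rewrite Eq Eq' rmorphM mulrACA -invfM -exprD; congr (_ / _ ^+ _).
by have := ltn_ord i; lia.
Qed.

Lemma homogeneous_invlin1 : homogeneous 0 (fun m => invlin 1 (m.+1%:R^-1 : R)).
Proof.
exists (fun e => (-1) ^+ e) => m e.
by rewrite /invlin expr1n divr1 [in LHS]exprNn exprVn addn0 rmorphXn/= rmorphN1.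
Qed.

Lemma homogeneous_invlin : homogeneous 1 (fun m => invlin (m.+1%:R : R) 1).
Proof.
exists (fun e => (-1) ^+ e) => m e.
by rewrite /invlin addn1 rmorphXn/= rmorphN1.
Qed.

Lemma homogeneous1 : homogeneous 0 (fun=> 1).
Proof.
exists (fun e => (e == 0%N)%:R) => m [|e].
  by rewrite fps1 rmorph_nat addn0 expr0 divr1.
by rewrite fps1 rmorph_nat mul0r.
Qed.

Lemma homogeneousX b u k : homogeneous b u -> homogeneous (k * b)%N (fun m => u m ^+ k).
Proof.
move=> hu; elim: k => [|k IH]; first exact: homogeneous1.
rewrite mulSn (_ : (fun m => _) = (fun m => u m * u m ^+ k)).
  exact: homogeneousM.
by apply/funext => m; rewrite exprS.
Qed.

(** A vanishing coefficient is exempt from the conditions. This serves constant terms, which would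
    not lower the degree, and the linear term of the tail product, which could bring in a divergent
    sum of 1/m. *)
Lemma summand_span_mul (q : nat -> rat) b w e u chi :
  (forall m i, u m i = ratr (q i) / m.+1%:R ^+ (i + b)) ->
  (forall i, (i <= e)%N -> q i = 0 \/
     [/\ (0 < i + b)%N, (1 < w)%N, (i + b <= w)%N &
       tail_span (w - (i + b))%N (fun m => chi m (e - i)%N)]) ->
  summand_span w (fun m => (u m * chi m.+1) e).
Proof.
move=> Eu H.
apply: (@rat_span_ext _ _ _ (fun m => \sum_(i <- index_enum 'I_e.+1)
   ratr (q i) * (chi m.+1 (e - i)%N / m.+1%:R ^+ (i + b)))).
  by move=> m; rewrite fpsM; apply: eq_bigr => i _; rewrite Eu [RHS]mulrAC mulrA.
apply: rat_span_sum => i _.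
have [|q0|[ib w1 ibw tsp]] := H i; first by rewrite -ltnS.
  by apply: rat_span_ext (rat_span0 _ _) => m; rewrite q0 rmorph0 mul0r.
apply: rat_span_ext (rat_spanZ (q i) (summand_span_div ib _ w1 tsp)) => //.
by rewrite subnK.
Qed.

Definition graded (d : nat) Phi :=
  forall e, tail_span (e + d)%N (fun m => Phi m e).

(** After division by 1 + X / m.+1, the difference of [Phi m] and [Phi m.+1] contains [Phi m.+1]
    only with a factor [v m] without constant term. Degree [e] thus calls on lower degrees of [Phi],
    and each power of X spent is repaid by a factor 1 / m.+1 of the same weight. *)
Lemma graded_rec b d u Phi chi : (0 < b)%N -> (1 < b + d)%N ->
  homogeneous b u -> graded d chi ->
  (forall m, lin 1 (m.+1%:R^-1) * Phi m = Phi m.+1 + u m * chi m.+1) ->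
  (forall e, (fun m => Phi m e) @ \oo --> 0) ->
  graded (b + d)%N Phi.
Proof.
move=> b0 bd hu gchi rec Phi0 e.
elim/ltn_ind: e => e IH.
have [q Eq] := homogeneousM homogeneous_invlin1 hu.
have [q' Eq'] := homogeneous_invlin1.
pose q1 i := if i is 0%N then 0 else q' i.
pose v (m : nat) : fps R := fun i => if i is 0%N then 0 else invlin 1 (m.+1%:R^-1) i.
have Ev m : invlin 1 (m.+1%:R^-1 : R) = 1 + v m.
  apply/funext => -[|i]; rewrite fpsD fps1 /= ?add0r// addr0.
  by rewrite /invlin expr0 expr1 divr1.
apply: (@tail_span_telescope _ _ _ (fun m => (v m * Phi m.+1) e +
    ((invlin 1 (m.+1%:R^-1) * u m) * chi m.+1) e)); last exact: Phi0.
- apply: rat_spanD.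
    apply: (@summand_span_mul q1 0).
      move=> m [|i]; first by rewrite /= rmorph0 mul0r.
      by rewrite /v Eq'.
    move=> [|i] ie; [by left|right].
    split=> //; [lia|lia|].
    rewrite addn0 (_ : (e + (b + d) - i.+1 = (e - i.+1) + (b + d))%N); last by lia.
    by apply: IH; lia.
  apply: (@summand_span_mul q b) => [m i|i ie]; first by rewrite Eq.
  right; split; [lia|lia|lia|].
  rewrite (_ : (e + (b + d) - (i + b) = (e - i) + d)%N); last by lia.
  exact: gchi.
- move=> m.
  have c0 : (1 : R) != 0 by rewrite oner_eq0.
  have E : Phi m = invlin 1 (m.+1%:R^-1) * (lin 1 (m.+1%:R^-1) * Phi m).
    by rewrite mulrA [invlin _ _ * _]mulrC lin_invlin// mul1r.
  rewrite [in LHS]E rec mulrDr mulrA fpsD {1}Ev mulrDl mul1r fpsD.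
  by ring.
Qed.

End Graded.

(** * The tail product of (1 + 2 a / j) / (1 + a / j)^2 *)

Section TailProduct.
Variable R : realType.

(* The coefficients of [(1 + 2 X) / (1 + X) ^ 2]. *)
Definition hcoef (i : nat) : rat := if i is j.+1 then (-1) ^+ j * j%:R else 1.

Definition hseries (m : nat) : fps R := fun i => ratr (hcoef i) / m%:R ^+ i.

Lemma hseriesE m : (0 < m)%N ->
  lin 1 (m%:R^-1) ^+ 2 * hseries m = lin 1 (2 / m%:R).
Proof.
move=> m0; have mn0 : m%:R != 0 :> R by rewrite pnatr_eq0 -lt0n.
rewrite expr2 -mulrA; apply/funext => -[|e].
  by rewrite !linM0 /hseries /= rmorph1 expr0 divr1 !mul1r.
rewrite linMS mul1r linMS mul1r; case: e => [|e].
  by rewrite linM0 /hseries /= mulr0 rmorph0 rmorph1 expr0 expr1; field.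
rewrite linMS mul1r; case: e => [|e].
  by rewrite /hseries /= !(rmorphM, rmorphXn, rmorphN1, rmorph_nat)/= rmorph1 !(exprS, expr0); field.
rewrite /hseries /= !(rmorphM, rmorphXn, rmorphN1, rmorph_nat)/=.
have -> : e.+2%:R = e%:R + 2 :> R by rewrite -addn2 natrD.
have -> : e.+1%:R = e%:R + 1 :> R by rewrite natr1.
rewrite !exprS; field.
by rewrite expf_neq0 ?mn0.
Qed.

(** Coefficient of degree [e] in (h_m - 1) prev, where h_m is [hseries m]; since h_m - 1 has no
    constant term, only lower degrees of [prev] occur. *)
Definition tail_product_summand (prev : nat -> nat -> R) e m :=
  \sum_(i < e) ratr (hcoef i.+1) / m%:R ^+ i.+1 * prev (e - i.+1)%N m.

(* [tail_product m] is the series in [a] of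
   [\prod_(j > m) (1 + 2 a / j) / (1 + a / j) ^ 2]; its coefficients are built by
   strong recursion on the degree. *)
Fixpoint tail_product_table (N e m : nat) : R :=
  if N is N'.+1 then
    if (e <= N')%N then tail_product_table N' e m
    else tail (tail_product_summand (tail_product_table N') e) m
  else (e == 0%N)%:R.

Definition tail_product (m : nat) : fps R := fun e => tail_product_table e e m.

Lemma tail_product_tableE N e m : (e <= N)%N ->
  tail_product_table N e m = tail_product m e.
Proof.
elim: N => [|N IH]; first by rewrite leqn0 => /eqP->.
rewrite leq_eqVlt => /predU1P[-> //|]; rewrite ltnS => eN.
by rewrite /= eN IH.
Qed.

Lemma tail_product0 m : tail_product m 0%N = 1.
Proof. by []. Qed.

Lemma tail_productS e m : tail_product m e.+1 =
  tail (tail_product_summand (fun e m => tail_product m e) e.+1) m.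
Proof.
rewrite /tail_product/= ltnn; congr (tail _ m); apply/funext => k.
by apply: eq_bigr => i _; rewrite tail_product_tableE// subSS leq_subr.
Qed.

Lemma geometric_le (x : R) n : 0 <= x < 1 -> \sum_(i < n) x ^+ i <= (1 - x)^-1.
Proof.
move=> /andP[x0 x1]; rewrite -[leRHS]mul1r ler_pdivlMr ?subr_gt0//.
rewrite mulrC -opprB mulNr -subrX1 opprB gerBl exprn_ge0//.
Qed.

Lemma hcoef_le i : `|ratr (hcoef i.+1) : R| <= 2 ^+ i.
Proof.
rewrite /= rmorphM rmorphXn rmorphN1 rmorph_nat normrM normrX normrN1 expr1n mul1r.
by rewrite normr_nat -natrX ler_nat ltnW// ltn_expl.
Qed.

(** As [hcoef 1] is 0, a factor m^-2 splits off. The bounds 2^(i+1) and 8^(e-i-1) then add up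
    geometrically to less than 8^e, which [dominated_div2] doubles. The base 8 is such that the
    factor 4 of [tail_le] gives back exactly 8^(e+1). *)
Lemma tail_product_dominated e :
  (forall i m, (i <= e)%N -> `|tail_product m i| <= 8 ^+ i) ->
  dominated (8 ^+ e.+1 / 4)
    (tail_product_summand (fun e m => tail_product m e) e.+1).
Proof.
move=> H.
pose phi m : R := \sum_(i < e) ratr (hcoef i.+2) / m%:R ^+ i * tail_product m (e.+1 - i.+2)%N.
have -> : tail_product_summand (fun e m => tail_product m e) e.+1 =
    fun m => phi m / m%:R ^+ 2.
  apply/funext => m; rewrite /tail_product_summand big_ord_recl /= mulr0 rmorph0 !mul0r add0r.
  rewrite mulr_suml; apply: eq_bigr => i _.
  rewrite (_ : m%:R ^+ _ = m%:R ^+ i * m%:R ^+ 2 :> R); last by rewrite -exprD addn2.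
  by rewrite invfM [RHS]mulrAC !mulrA.
have H2 : forall m, `|phi m| <= 8 ^+ e.+1 / 8.
  move=> m; apply: le_trans (ler_norm_sum _ _ _) _.
  have term (i : 'I_e) : `|ratr (hcoef i.+2) / m%:R ^+ i * tail_product m (e.+1 - i.+2)%N|
      <= 8 ^+ e / 4 * 4^-1 ^+ i.
    have ie := ltn_ord i.
    rewrite normrM normf_div.
    have A : `|ratr (hcoef i.+2) : R| / `|m%:R ^+ i| <= 2 ^+ i.+1.
      rewrite -[leRHS]mulr1; apply: ler_pM; rewrite ?invr_ge0 ?hcoef_le//.
      rewrite normrX normr_nat; case: m => [|m].
        by case: (i : nat) => [|j]; rewrite ?expr0 ?invr1// exprS mul0r invr0.
      by rewrite invf_le1 ?exprn_gt0// exprn_ege1// ler1n.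
    have B := H _ m (_ : (e.+1 - i.+2 <= e)%N).
    apply: le_trans (ler_pM _ _ A (B _)) _; rewrite ?mulr_ge0 ?invr_ge0//; first by lia.
    have -> : (e.+1 - i.+2 = e - i.+1)%N by lia.
    have -> : 8 ^+ e = 8 ^+ i.+1 * 8 ^+ (e - i.+1) :> R by rewrite -exprD; congr (_ ^+ _); lia.
    have -> : 8 ^+ i.+1 = 2 ^+ i.+1 * 4 ^+ i.+1 :> R by rewrite -exprMn; congr (_ ^+ _); ring.
    rewrite exprVn [4 ^+ i.+1]exprS le_eqVlt; apply/orP; left; apply/eqP; field.
    by rewrite expf_neq0.
  apply: le_trans (ler_sum _ (fun i _ => term i)) _.
  rewrite -mulr_sumr; have G := @geometric_le 4^-1 e.
  have G' : \sum_(i < e) 4^-1 ^+ i <= 4 / 3 :> R.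
    have -> : 4 / 3 = (1 - 4^-1)^-1 :> R by field.
    by apply: G; apply/andP; split; lra.
  apply: le_trans (ler_wpM2l _ G') _; first by rewrite divr_ge0// exprn_ge0.
  have E0 : 0 <= 8 ^+ e :> R by rewrite exprn_ge0.
  rewrite exprS; move: E0; move: (8 ^+ e : R) => x x0; lra.
have -> : 8 ^+ e.+1 / 4 = 2 * (8 ^+ e.+1 / 8) :> R by field.
exact: dominated_div2.
Qed.

Lemma tail_product_le e m : `|tail_product m e.+1| <= 8 ^+ e.+1 * wt R m.
Proof.
elim/ltn_ind: e m => e IH m.
have H i k : (i <= e)%N -> `|tail_product k i| <= 8 ^+ i.
  case: i => [_|i ie]; first by rewrite tail_product0 normr1.
  apply: le_trans (IH _ ie k) _.
  by rewrite -[leRHS]mulr1 ler_wpM2l ?exprn_ge0// wt_le1.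
rewrite tail_productS; apply: le_trans (tail_le (tail_product_dominated H) m) _.
by rewrite mulrCA divff ?mulr1// pnatr_eq0.
Qed.

Lemma tail_product_bound e m : `|tail_product m e| <= 8 ^+ e.
Proof.
case: e => [|e]; first by rewrite tail_product0 normr1.
apply: le_trans (tail_product_le e m) _.
by rewrite -[leRHS]mulr1 ler_wpM2l ?exprn_ge0// wt_le1.
Qed.

Lemma tail_product_cvg0 e : (fun m => tail_product m e.+1) @ \oo --> 0.
Proof.
have D := @tail_product_dominated e (fun i m _ => tail_product_bound i m).
by under eq_fun do rewrite tail_productS; exact: tail_cvg0 D.
Qed.

Lemma tail_product_rec m :
  tail_product m = hseries m.+1 * tail_product m.+1.
Proof.
apply/funext => e; rewrite fpsM big_ord_recl subn0 /hseries/= rmorph1 expr0 divr1 mul1r.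
case: e => [|e]; first by rewrite big_ord0 addr0.
have D := @tail_product_dominated e (fun i m _ => tail_product_bound i m).
by rewrite tail_productS (tail_rec D) -tail_productS addrC.
Qed.

Lemma tail_product_lin m : lin 1 (m.+1%:R^-1) ^+ 2 * tail_product m =
  lin 1 (2 / m.+1%:R) * tail_product m.+1.
Proof. by rewrite tail_product_rec mulrA hseriesE. Qed.

(** Since h - 1 starts in degree 2, every new summation index enters with exponent at least 2, so
    all the nested sums converge. *)
Lemma tail_product_graded : graded 0 tail_product.
Proof.
move=> e; rewrite addn0; elim/ltn_ind: e => -[_|e IH].
  exists [:: (1, [::])]; split=> [p|n]; first by rewrite inE => /eqP ->.
  by rewrite big_seq1 rmorph1 mulr1.
pose q i : rat := if i is 0%N then 0 else hcoef i.
pose v (m : nat) : fps R := fun i => ratr (q i) / m.+1%:R ^+ (i + 0).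
apply: (@tail_span_telescope _ _ _ (fun m => (v m * tail_product m.+1) e.+1)).
- apply: (@summand_span_mul _ q 0) => // i ie.
  case: i ie => [|[|i]] ie; [by left|by left; rewrite /= mulr0|right].
  rewrite addn0; split=> //; first lia.
  by apply: IH; lia.
- move=> m; rewrite [in LHS]tail_product_rec (_ : hseries m.+1 = 1 + v m).
    by rewrite mulrDl mul1r fpsD [X in X - _]addrC addrK.
  apply/funext => -[|i]; rewrite fpsD fps1 /hseries /v /= ?rmorph0 ?rmorph1 ?addn0.
    by rewrite expr0 divr1 mul0r addr0.
  by rewrite add0r.
- exact: tail_product_cvg0.
Qed.

End TailProduct.

(** * Taylor coefficients of products, inverses and powers *)

Section Jets.
Variable R : realType.
Implicit Types (c d : fps R) (f g : R -> R).

Definition fps_deriv c : fps R := pseries_diffs c.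

Lemma fps_derivD c d : fps_deriv (c + d) = fps_deriv c + fps_deriv d.
Proof. by apply/funext => e; rewrite fpsD /fps_deriv /pseries_diffs fpsD mulrDr. Qed.

Lemma fps_derivN c : fps_deriv (- c) = - fps_deriv c.
Proof. by apply/funext => e; rewrite fpsN /fps_deriv /pseries_diffs fpsN mulrN. Qed.

Lemma fps_derivM c d :
  fps_deriv (c * d) = fps_deriv c * d + c * fps_deriv d.
Proof.
apply/funext => e; rewrite fpsD !fpsM /fps_deriv /pseries_diffs fpsM mulr_sumr.
have E (i : 'I_e.+2) : e.+1%:R * (c i * d (e.+1 - i)%N) =
    i%:R * c i * d (e.+1 - i)%N + c i * ((e.+1 - i)%:R * d (e.+1 - i)%N).
  rewrite natrB; last by rewrite -ltnS.
  by ring.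
under eq_bigr do rewrite E.
rewrite big_split/=; congr (_ + _).
  rewrite big_ord_recl /= !mul0r add0r; apply: eq_bigr => i _.
  by rewrite subSS.
rewrite big_ord_recr /= subnn mul0r mulr0 addr0; apply: eq_bigr => i _.
by rewrite subSn// -ltnS.
Qed.

Lemma fps_derivV c d : c * d = 1 -> fps_deriv d = - (d * d * fps_deriv c).
Proof.
move=> cd; have := congr1 fps_deriv cd.
have -> : fps_deriv 1 = 0.
  by apply/funext => e; rewrite /fps_deriv /pseries_diffs fps1 mulr0 fps0.
rewrite fps_derivM => H.
have -> : fps_deriv d = d * (fps_deriv c * d + c * fps_deriv d) - d * d * fps_deriv c
   + (1 - c * d) * fps_deriv d by ring.
by rewrite H cd; ring.
Qed.

Section Jet.
Variables (x r : R).

(* [jet n f c]: [f] is [n] times differentiable on the ball of radius [r] around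
   [x], with Taylor coefficients at [x] given by [c] up to order [n]. *)
Fixpoint jet n f c : Prop := f x = c 0%N /\
  if n is n'.+1 then
    exists f', (forall y, `|y - x| < r -> is_derive y 1 f (f' y)) /\
      jet n' f' (fps_deriv c)
  else True.

Lemma jet0 n f c : jet n f c -> f x = c 0%N.
Proof. by case: n => [|n] []. Qed.

Lemma jet_le n f c : jet n.+1 f c -> jet n f c.
Proof.
elim: n f c => [|n IH] f c; first by case.
by move=> [f0 [f' [Hf' /IH J]]]; split=> //; exists f'.
Qed.

Lemma jetD n f g c d : jet n f c -> jet n g d -> jet n (fun y => f y + g y) (c + d).
Proof.
elim: n f g c d => [|n IH] f g c d [f0 Hf] [g0 Hg]; split; rewrite /= ?f0 ?g0//.
move: Hf Hg => [f' [Hf' Jf]] [g' [Hg' Jg]]; exists (fun y => f' y + g' y).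
split; last by rewrite fps_derivD; exact: IH.
by move=> y yr; have := is_deriveD (Hf' y yr) (Hg' y yr).
Qed.

Lemma jetN n f c : jet n f c -> jet n (fun y => - f y) (- c).
Proof.
elim: n f c => [|n IH] f c [f0 Hf]; split; rewrite /= ?f0//.
move: Hf => [f' [Hf' Jf]]; exists (fun y => - f' y).
split; last by rewrite fps_derivN; exact: IH.
by move=> y yr; have := is_deriveN (Hf' y yr).
Qed.

Lemma jetM n f g c d : jet n f c -> jet n g d -> jet n (fun y => f y * g y) (c * d).
Proof.
elim: n f g c d => [|n IH] f g c d Jf Jg.
  by split=> //; rewrite (jet0 Jf) (jet0 Jg) fpsM big_ord1.
split; first by rewrite (jet0 Jf) (jet0 Jg) fpsM big_ord1.
have [_ [f' [Hf' Jf']]] := Jf; have [_ [g' [Hg' Jg']]] := Jg.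
exists (fun y => f' y * g y + f y * g' y); split.
  move=> y yr; apply: is_derive_eq (is_deriveM (Hf' y yr) (Hg' y yr)) _.
  by rewrite /GRing.scale/=; ring.
by rewrite fps_derivM; apply: jetD; apply: IH => //; exact: jet_le.
Qed.

Lemma jet_lin n (c0 c1 : R) : jet n (fun y => c0 + c1 * (y - x)) (lin c0 c1).
Proof.
elim: n c0 c1 => [|n IH] c0 c1; split; rewrite /= ?subrr ?mulr0 ?addr0//.
exists (fun y => c1 + 0 * (y - x)); split.
  by move=> y _; apply: is_derive_eq; rewrite /GRing.scale/=; ring.
rewrite (_ : fps_deriv _ = lin c1 0)//.
by apply/funext => -[|[|e]]; rewrite /fps_deriv /pseries_diffs/= ?mul1r ?mulr0.
Qed.

Lemma jet1 n : jet n (fun=> 1) 1.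
Proof.
rewrite -lin1; have := jet_lin n 1 0.
by rewrite (_ : (fun y => _) = fun=> 1)//; apply/funext => y; rewrite mul0r addr0.
Qed.

Lemma jetX n f c k : jet n f c -> jet n (fun y => f y ^+ k) (c ^+ k).
Proof.
move=> J; elim: k => [|k IH]; first exact: jet1.
rewrite exprS (_ : (fun y => _) = fun y => f y * f y ^+ k); first exact: jetM.
by apply/funext => y; rewrite exprS.
Qed.

Lemma jet_prod n (F : nat -> R -> R) (c : nat -> fps R) k :
  (forall j, jet n (F j) (c j)) ->
  jet n (fun y => \prod_(j < k) F j y) (\prod_(j < k) c j).
Proof.
move=> J; elim: k => [|k IH].
  rewrite big_ord0 (_ : (fun y => _) = fun=> 1); first exact: jet1.
  by apply/funext => y; rewrite big_ord0.
rewrite big_ord_recr/= (_ : (fun y => _) = fun y => \prod_(j < k) F j y * F k y).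
  exact: jetM.
by apply/funext => y; rewrite big_ord_recr.
Qed.

Lemma jetV n f c d : (forall y, `|y - x| < r -> f y != 0) -> 0 < r ->
  c * d = 1 -> jet n f c -> jet n (fun y => (f y)^-1) d.
Proof.
move=> f0 r0 cd.
have fx0 : f x != 0 by apply: f0; rewrite subrr normr0.
have d0 : f x = c 0%N -> (f x)^-1 = d 0%N.
  move=> E; have := congr1 (fun u : fps R => u 0%N) cd.
  rewrite fpsM big_ord1 fps1/= -E subn0 => H.
  by apply: (mulfI fx0); rewrite divff// H.
elim: n => [|n IH] Jf; first by split=> //; apply: d0; case: Jf.
split; first by apply: d0; case: Jf.
have [_ [f' [Hf' Jf']]] := Jf.
exists (fun y => - ((f y)^-1 * (f y)^-1 * f' y)); split.
  move=> y yr; apply: is_derive_eq (is_deriveV (f0 y yr) (Hf' y yr)) _.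
  by rewrite /GRing.scale/=; field; exact: f0.
rewrite (fps_derivV cd); apply: jetN; apply: jetM => //.
by apply: jetM; apply: IH; exact: jet_le.
Qed.

Lemma near_ball y : `|y - x| < r -> \forall z \near y, `|z - x| < r.
Proof.
move=> yr; have d0 : 0 < r - `|y - x| by rewrite subr_gt0.
near=> z; rewrite (_ : z - x = (z - y) + (y - x)); last by ring.
apply: le_lt_trans (ler_normD _ _) _; rewrite -ltrBrDr distrC.
by near: z; exact: cvgr_dist_lt.
Unshelve. all: by end_near. Qed.

Lemma eq_derive1n n f g : 0 < r -> (forall y, `|y - x| < r -> f y = g y) ->
  forall y, `|y - x| < r -> derive1n n f y = derive1n n g y.
Proof.
move=> r0 fg; elim: n => [|n IH] y yr; first exact: fg.
rewrite !derive1nS !derive1E; apply: near_eq_derive.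
by near=> z; apply: IH; near: z; exact: near_ball.
Unshelve. all: by end_near. Qed.

Lemma jet_derive1n n f c : 0 < r -> jet n f c -> derive1n n f x = n`!%:R * c n.
Proof.
move=> r0; elim: n f c => [|n IH] f c; first by move=> [E _]; rewrite fact0 mul1r -E.
move=> [_ [f' [Hf' J]]]; rewrite /derive1n iterSr -/(derive1n n _).
rewrite (@eq_derive1n n _ f')// ?subrr ?normr0//; last first.
  by move=> y yr; rewrite derive1E; have [_ ->] := Hf' y yr.
rewrite (IH _ _ J) /fps_deriv /pseries_diffs factS natrM.
by ring.
Qed.

End Jet.
End Jets.

(** * Euler's integral: functional equation and growth *)

Section GammaFunction.
Variable R : realType.
Implicit Types (z t y s : R).
Local Notation mu := (@lebesgue_measure R).

Definition gamma_integrand z t : R := t `^ (z - 1) * expR (- t).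

(** Extended real values allow the functional equation to be proved before finiteness, which is then
    deduced from it. *)
Definition eGamma z : \bar R :=
  (\int[mu]_(t in `]0%R, +oo[) (gamma_integrand z t)%:E)%E.

Lemma gamma_integrand_ge0 z t : 0 <= gamma_integrand z t.
Proof. by rewrite mulr_ge0 ?powR_ge0 ?expR_ge0. Qed.

Lemma measurable_gamma_integrand z (D : set R) :
  measurable_fun D (gamma_integrand z).
Proof.
apply: measurable_funTS; apply: measurable_funM.
  exact: measurable_powR.
apply: measurableT_comp; first exact: measurable_expR.
exact: (continuous_measurable_fun opp_continuous).
Qed.

Lemma measurable_gamma_integrandE z (D : set R) :
  measurable_fun D (fun t => (gamma_integrand z t)%:E).
Proof. by apply/measurable_EFinP; exact: measurable_gamma_integrand. Qed.

Lemma eGamma_ge0 z : (0 <= eGamma z)%E.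
Proof. by apply: integral_ge0 => t _; rewrite lee_fin gamma_integrand_ge0. Qed.

Lemma GammaE z : Gamma z = fine (eGamma z).
Proof. by []. Qed.

Lemma is_derive_gamma_integrand z t : 0 < t ->
  is_derive t 1 (gamma_integrand (z + 1))
    (z * gamma_integrand z t - gamma_integrand (z + 1) t).
Proof.
move=> t0.
have d1 : is_derive t (1 : R) (@powR R ^~ z) (z * t `^ (z - 1)).
  apply: DeriveDef; first by apply: derivable_powR; rewrite in_itv/= t0.
  by rewrite -derive1E powR_derive1// in_itv/= t0.
rewrite /gamma_integrand addrK.
have d2 : is_derive t (1 : R) (fun t => expR (- t)) (- expR (- t)).
  by apply: is_derive_eq; rewrite /GRing.scale/= mulrN1.
apply: (is_derive_eq (is_deriveM d1 d2)).
by rewrite /GRing.scale/=; ring.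
Qed.

Lemma gamma_integrand_cvg0 z : 0 < z ->
  gamma_integrand (z + 1) t @[t --> +oo] --> 0.
Proof.
move=> z0.
have z20 : 0 < z * 2 by rewrite mulr_gt0.
have [C C0 HC] : exists2 C : R, 0 < C &
    forall t, 0 < t -> gamma_integrand (z + 1) t <= C * expR (- (t / 2)).
  exists (expR (z * ln (z * 2))); first exact: expR_gt0.
  move=> t t0; rewrite /gamma_integrand addrK /powR gt_eqF// -!expRD ler_expR.
  (* The point t / (2 z) is chosen so that z ln (t / (2 z)) is at most t / 2, half of the
     exponential decay. *)
  have := ltW (ln_sublinear (divr_gt0 t0 z20)).
  rewrite ln_div ?posrE// lerBlDr => /(ler_wpM2l (ltW z0)).
  rewrite mulrDr (_ : z * (t / (z * 2)) = t / 2); last first.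
    by field; rewrite gt_eqF.
  by lra.
have ub : C * expR (- (t / 2)) @[t --> +oo] --> 0.
  rewrite -(mulr0 C); apply: cvgMr.
  apply: (@cvg_comp _ _ _ (fun t : R => t / 2) (fun t => expR (- t)) _ +oo).
    apply/cvgryPge => A; near=> t.
    by rewrite ler_pdivlMr//; near: t; exact: nbhs_pinfty_ge.
  exact: cvgr_expR.
apply: (squeeze_cvgr _ (cvg_cst 0) ub).
near=> t; rewrite gamma_integrand_ge0/=; apply: HC.
by near: t; exact: nbhs_pinfty_gt.
Unshelve. all: by end_near. Qed.

Lemma gamma_integrand_right0 z : 0 < z ->
  gamma_integrand (z + 1) t @[t --> 0^'+] --> 0.
Proof.
move=> z0; have h1 : t `^ z @[t --> (0:R)^'+] --> (0 : R) by exact: powR_cvg0.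
have h2 : expR (- t) @[t --> (0:R)^'+] --> expR (- (0:R)).
  apply: cvg_at_right_filter.
  exact: (@continuous_comp _ _ _ -%R expR 0 (@oppr_continuous _ _ _) (@continuous_expR _ _)).
have -> : gamma_integrand (z + 1) = (@powR R ^~ z) * (fun t => expR (- t)).
  by apply/funext => t; rewrite /gamma_integrand addrK.
have := cvgM h1 h2; rewrite mul0r; exact.
Qed.


Lemma continuous_gamma_integrand z t : 0 < t ->
  {for t, continuous (gamma_integrand z)}.
Proof.
move=> t0; have := is_derive_gamma_integrand (z - 1) t0.
rewrite subrK => -[/derivable1_diffP/differentiable_continuous + _]; exact.
Qed.

(* [t ^ z * exp (- t)] increases up to [t = z] and decreases afterwards: on each
   side its derivative has a constant sign, so that only integrals of
   nonnegative functions occur and integrability is not needed. *)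
Lemma eGammaS z : 1 <= z -> eGamma (z + 1) = (z%:E * eGamma z)%E.
Proof.
move=> z1; have z0 : 0 < z := lt_le_trans ltr01 z1.
pose f t : R := gamma_integrand (z + 1) t - z * gamma_integrand z t.
have fE t : 0 < t -> f t = gamma_integrand z t * (t - z).
  move=> t0; rewrite /f /gamma_integrand addrK -(mulr_powRB1 (ltW t0) z0).
  ring.
have cf t : 0 < t -> {for t, continuous f}.
  move=> t0; apply: cvgB; first exact: continuous_gamma_integrand.
  by apply: cvgMr; exact: continuous_gamma_integrand.
have splitE (g : R -> R) : (forall t, 0 <= g t) -> measurable_fun setT g ->
    (\int[mu]_(t in `]0%R, +oo[) (g t)%:E =
     \int[mu]_(t in `]0%R, z]) (g t)%:E + \int[mu]_(t in `[z, +oo[) (g t)%:E)%E.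
  move=> g0 mg.
  have mgE D : measurable_fun D (fun t => (g t)%:E).
    exact/measurable_EFinP/measurable_funTS.
  rewrite -(integral_itv_obnd_cbnd (r := z)) //.
  rewrite -ge0_integral_setU//; last 3 first.
    exact: mgE.
    by move=> t _; rewrite lee_fin.
    apply/disj_setPS => t []/=; rewrite !in_itv/= => /andP[_ tz] /andP[].
    by rewrite ltNge tz.
  congr (integral _ _ _); apply/seteqP; split => t /=; rewrite !in_itv/= !andbT.
    by move=> ->/=; case: leP => _; [left|right].
  by move=> [/andP[]//|]; exact: lt_trans.
have mG y := @measurable_gamma_integrand y setT.
have mGE y (D : set R) := @measurable_gamma_integrandE y D.
have mf : measurable_fun setT f.
  by apply: measurable_funB => //; apply: measurable_funM.
(* Right continuity at 0 holds also for z = 1, because the power 0^0 is 1 by convention. *)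
have u_right0 : gamma_integrand z t @[t --> (0:R)^'+] --> gamma_integrand z 0.
  have [z1' | ] := ltP 1 z.
    have := @gamma_integrand_right0 (z - 1); rewrite subrK subr_gt0 => /(_ z1').
    by rewrite {3}/gamma_integrand powR0 ?mul0r// subr_eq0 gt_eqF.
  move=> zle1; have -> : z = 1 by apply/eqP; rewrite eq_le zle1 z1.
  have -> : gamma_integrand 1 = fun t => expR (- t).
    by apply/funext => t; rewrite /gamma_integrand subrr powRr0 mul1r.
  apply: cvg_at_right_filter.
  exact: (@continuous_comp _ _ _ -%R expR 0 (@oppr_continuous _ _ _) (@continuous_expR _ _)).
have right_tail : (\int[mu]_(t in `[z, +oo[) (gamma_integrand (z + 1) t)%:E =
    (gamma_integrand (z + 1) z)%:E +
    \int[mu]_(t in `[z, +oo[) (z * gamma_integrand z t)%:E)%E.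
  (* Clamping the argument at z yields a function that is continuous on the whole line and agrees
     with [f] on the half-line of integration. *)
  pose f' t := gamma_integrand z (Num.max z t) * (Num.max z t - z).
  have f'E t : z <= t -> f' t = f t.
    by move=> zt; rewrite /f' max_r// fE// (lt_le_trans z0).
  have cf' : continuous f'.
    move=> t; have mx : {for t, continuous (fun t => Num.max z t)}.
      exact: (@continuous_max R R (fun=> z) id t (cvg_cst _) cvg_id).
    apply: cvgM; last by apply: cvgB; [exact: mx | exact: cvg_cst].
    apply: (@continuous_comp _ _ _ _ (gamma_integrand z)) => //.
    by apply: continuous_gamma_integrand; rewrite lt_max z0.
  have <- : (\int[mu]_(t in `[z, +oo[) (f' t)%:E = (gamma_integrand (z + 1) z)%:E)%E.
    rewrite (@ge0_continuous_FTC2y R f' (fun t => - gamma_integrand (z + 1) t) z 0).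
    - by rewrite EFinN oppeK add0e.
    - by move=> t zt; rewrite mulr_ge0 ?gamma_integrand_ge0// subr_ge0 le_max lexx.
    - exact: continuous_subspaceT.
    - by rewrite -oppr0; apply: cvgN; exact: gamma_integrand_cvg0.
    - move=> t zt; apply: derivableN.
      by have [] := is_derive_gamma_integrand z (lt_trans z0 zt).
    - apply: cvg_at_right_filter; apply: cvgN.
      exact: continuous_gamma_integrand.
    - move=> t; rewrite in_itv/= andbT => zt; have t0 := lt_trans z0 zt.
      have [d1 d2] := is_derive_gamma_integrand z t0.
      by rewrite derive1E deriveN// d2 f'E ?(ltW zt)// opprB.
  rewrite -ge0_integralD//.
  - apply: eq_integral => t; rewrite inE/= in_itv/= andbT => zt.
    by rewrite -EFinD f'E// /f subrK.
  - by move=> t; rewrite /= in_itv/= andbT => zt; rewrite lee_fin mulr_ge0 ?gamma_integrand_ge0// subr_ge0 le_max lexx.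
  - by apply/measurable_EFinP; apply: measurable_funTS; exact: continuous_measurable_fun.
  - by move=> t _; rewrite lee_fin mulr_ge0 ?gamma_integrand_ge0// ltW.
  - by apply/measurable_EFinP/measurable_funM => //; exact: measurable_gamma_integrand.
have left_part : (\int[mu]_(t in `]0%R, z]) (z * gamma_integrand z t)%:E =
    (gamma_integrand (z + 1) z)%:E +
    \int[mu]_(t in `]0%R, z]) (gamma_integrand (z + 1) t)%:E)%E.
  have <- : (\int[mu]_(t in `]0%R, z]) (- f t)%:E = (gamma_integrand (z + 1) z)%:E)%E.
    rewrite integral_itv_obnd_cbnd; last first.
      by apply/measurable_EFinP; apply: measurable_funTS; exact: measurable_funN.
    rewrite (@continuous_FTC2 R (fun t => - f t) (gamma_integrand (z + 1)) 0 z)//.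
    - by rewrite /gamma_integrand addrK powR0 ?gt_eqF// mul0r sube0.
    - apply/continuous_within_itvP => //; split.
      + by move=> t; rewrite in_itv/= => /andP[t0 _]; apply: cvgN; exact: cf.
      + apply: cvgN; apply: cvgB; last by apply: cvgMr.
        rewrite {2}/gamma_integrand addrK powR0 ?gt_eqF// mul0r.
        exact: gamma_integrand_right0.
      + by apply: cvg_at_left_filter; apply: cvgN; exact: cf.
    - split.
      + move=> t; rewrite in_itv/= => /andP[t0 _].
        by have [] := is_derive_gamma_integrand z t0.
      + rewrite {2}/gamma_integrand addrK powR0 ?gt_eqF// mul0r.
        exact: gamma_integrand_right0.
      + by apply: cvg_at_left_filter; exact: continuous_gamma_integrand.
    - move=> t; rewrite in_itv/= => /andP[t0 _].
      have [_ d2] := is_derive_gamma_integrand z t0.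
      by rewrite derive1E d2 /f opprB.
  rewrite -ge0_integralD//.
  - apply: eq_integral => t _.
    by rewrite -EFinD /f opprB subrK.
  - move=> t/=; rewrite in_itv/= => /andP[t0 tz].
    by rewrite lee_fin fE// -mulrN mulr_ge0 ?gamma_integrand_ge0// opprB subr_ge0.
  - by apply/measurable_EFinP; apply: measurable_funTS; exact: measurable_funN.
  - by move=> t _; rewrite lee_fin gamma_integrand_ge0.
  - exact: mGE.
have E1 : eGamma (z + 1) = _ := splitE _ (gamma_integrand_ge0 (z + 1)) (mG _).
(* The boundary value at z passes from the right half to the left half; nothing possibly infinite is
   subtracted. *)
rewrite E1 right_tail addeCA addeA -left_part.
have mz : measurable_fun setT (fun t => z * gamma_integrand z t).
  exact: measurable_funM.
have z_ge0 t : 0 <= z * gamma_integrand z t.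
  by rewrite mulr_ge0 ?gamma_integrand_ge0// ltW.
have := splitE _ z_ge0 mz => /= <-.
rewrite /eGamma -ge0_integralZl_EFin//; last exact: ltW.
- by move=> t _; rewrite lee_fin gamma_integrand_ge0.
- exact: mGE.
Qed.


Lemma eGamma1 : eGamma 1 = 1%E.
Proof.
rewrite -(integral_exponential_pdf (@ltr01 R)) /eGamma.
rewrite [RHS](_ : _ = \int[mu]_(t in `[0%R, +oo[) (expR (- t))%:E)%E; last first.
  rewrite [RHS]integral_mkcond; apply: eq_integral => t _.
  rewrite /exponential_pdf !patchE; case: ifP => // _.
  by rewrite mul1r mulN1r.
rewrite -integral_itv_obnd_cbnd.
  apply: eq_integral => t _.
  by rewrite /gamma_integrand subrr powRr0 mul1r.
apply/measurable_EFinP; apply: measurable_funTS; apply: measurableT_comp => //.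
Qed.

(** The tangent bound exp x >= 1 + x is used at (1 - s) ln v and at - s ln v; with weights s and 1 -
    s the logarithms cancel. *)
Lemma powR_le_affine v s : 0 < v -> 0 <= s <= 1 -> v `^ s <= 1 - s + s * v.
Proof.
move=> v0 /andP[s0 s1]; rewrite /powR gt_eqF//.
set L := ln v; have vE : v = expR (s * L) * expR ((1 - s) * L).
  by rewrite -expRD -mulrDl subrKC mul1r lnK.
have oneE : 1 = expR (s * L) * expR (- (s * L)) by rewrite expRxMexpNx_1.
have A1 := expR_ge1Dx ((1 - s) * L); have A2 := expR_ge1Dx (- (s * L)).
have E0 := ltW (expR_gt0 (s * L)).
have B1 : s * (expR (s * L) * (1 + (1 - s) * L)) <= s * v.
  by rewrite vE ler_wpM2l// ler_wpM2l.
have B2 : (1 - s) * (expR (s * L) * (1 - s * L)) <= 1 - s.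
  rewrite -[leRHS]mulr1 [X in _ <= _ * X]oneE ler_wpM2l ?subr_ge0//.
  exact: ler_wpM2l.
by lra.
Qed.

(** Bernoulli's inequality is applied to t / y, so that the right-hand side collapses to y^s
    Gamma(y) once the functional equation is known. *)
Lemma eGamma_Bernoulli y s : 0 < y -> 0 <= s <= 1 ->
  (eGamma (y + s) <= (y `^ s)%:E * ((1 - s)%:E * eGamma y + (s / y)%:E * eGamma (y + 1)))%E.
Proof.
move=> y0 s01; have /andP[s0 s1] := s01.
have c1 : 0 <= 1 - s by rewrite subr_ge0.
have c2 : 0 <= s / y by rewrite divr_ge0// ltW.
have gE z : forall t, `]0%R, +oo[%classic t -> (0 <= (gamma_integrand z t)%:E)%E.
  by move=> t _; rewrite lee_fin gamma_integrand_ge0.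
have mGE z (D : set R) := @measurable_gamma_integrandE z D.
have gkE k z : 0 <= k -> forall t, `]0%R, +oo[%classic t ->
    (0 <= k%:E * (gamma_integrand z t)%:E)%E.
  by move=> k0 t _; rewrite -EFinM lee_fin mulr_ge0// gamma_integrand_ge0.
have mGkE k z (D : set R) : measurable_fun D (fun t => k%:E * (gamma_integrand z t)%:E)%E.
  apply/measurable_EFinP; apply: measurable_funM => //.
  exact: measurable_gamma_integrand.
rewrite /eGamma -!ge0_integralZl_EFin//; try exact: gE; try exact: mGE.
rewrite -ge0_integralD//; try exact: gkE; try exact: mGkE.
rewrite -ge0_integralZl_EFin//; first last.
- exact: powR_ge0.
- by apply: emeasurable_funD; exact: mGkE.
- by move=> t t0; apply: adde_ge0; exact: gkE.
apply: ge0_le_integral => //.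
- by move=> t; exact: gE.
- exact: mGE.
- apply: measurable_funeM; apply: emeasurable_funD; exact: mGkE.
move=> t; rewrite /= in_itv/= andbT => t0.
rewrite -!EFinM lee_fin /gamma_integrand.
have tn0 : t != 0 by rewrite gt_eqF.
have -> : y + 1 - 1 = (y - 1) + 1 by ring.
have -> : y + s - 1 = (y - 1) + s by ring.
rewrite (@powRD _ _ (y - 1) 1) ?tn0 ?implybT// (@powRD _ _ (y - 1) s) ?tn0 ?implybT//.
rewrite powRr1 ?(ltW t0)//.
have -> : t `^ s = y `^ s * (t / y) `^ s.
  by rewrite -powRM ?divr_ge0 ?(ltW y0) ?(ltW t0)// mulrC divfK// gt_eqF.
have b := powR_le_affine (divr_gt0 t0 y0) s01.
have -> : y `^ s * ((1 - s) * (t `^ (y - 1) * expR (- t)) +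
   s / y * (t `^ (y - 1) * t * expR (- t))) =
   t `^ (y - 1) * (y `^ s * (1 - s + s * (t / y))) * expR (- t) by ring.
rewrite ler_wpM2r ?expR_ge0// ler_wpM2l ?powR_ge0// ler_wpM2l ?powR_ge0//.
Qed.

Lemma eGamma_fin z : 1 <= z -> eGamma z \is a fin_num.
Proof.
have fin_nat n : (eGamma n.+1%:R < +oo)%E.
  elim: n => [|n IH]; first by rewrite eGamma1 ltry.
  rewrite -natr1 eGammaS ?ler1n//.
  by apply: lte_mul_pinfty; rewrite ?lee_fin.
move=> z1; rewrite ge0_fin_numE ?eGamma_ge0//.
have [n /andP[n1 nz]] : exists n, (n.+1%:R <= z < n.+2%:R)%R.
  have := truncn_itv (le_trans ler01 z1); case: (Num.truncn z) => [|n] /andP[zn nz].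
    by move: nz; rewrite ltNge z1.
  by exists n; rewrite zn nz.
have := @eGamma_Bernoulli n.+1%:R (z - n.+1%:R).
rewrite subrKC natr1 ltr0n => /(_ isT) H; apply: le_lt_trans (H _) _.
  by rewrite subr_ge0 n1/= lerBlDr addrC natr1 ltW.
apply: lte_mul_pinfty => //; apply: lte_add_pinfty.
  apply: lte_mul_pinfty => //.
  by rewrite lee_fin subr_ge0 lerBlDr addrC natr1 ltW.
apply: lte_mul_pinfty; first by rewrite lee_fin divr_ge0// subr_ge0.
- by [].
exact: fin_nat.
Qed.

Lemma GammaS z : 1 <= z -> Gamma (z + 1) = z * Gamma z.
Proof.
by move=> z1; rewrite !GammaE eGammaS// fineM// eGamma_fin.
Qed.

Lemma Gamma1 : Gamma 1 = 1 :> R.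
Proof. by rewrite GammaE eGamma1. Qed.

Lemma Gamma_shift_le y s : 1 <= y -> 0 <= s <= 1 ->
  Gamma (y + s) <= y `^ s * Gamma y.
Proof.
move=> y1 s01; have y0 := lt_le_trans ltr01 y1.
have /andP[s0 s1] := s01.
have := eGamma_Bernoulli y0 s01; rewrite eGammaS//.
have ys1 : 1 <= y + s by apply: le_trans y1 _; rewrite lerDl.
rewrite -(fineK (eGamma_fin ys1)) -(fineK (eGamma_fin y1)) -!GammaE.
rewrite -!EFinM lee_fin.
suff -> : (1 - s) * Gamma y + s / y * (y * Gamma y) = Gamma y by [].
by field; rewrite gt_eqF.
Qed.

(** The upper bound, started at y + s with the complementary step 1 - s, lands on y + 1. *)
Lemma Gamma_shift_ge y s : 1 <= y -> 0 <= s <= 1 ->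
  y * Gamma y <= (y + s) `^ (1 - s) * Gamma (y + s).
Proof.
move=> y1 /andP[s0 s1].
have := @Gamma_shift_le (y + s) (1 - s); rewrite -GammaS// (_ : y + s + (1 - s) = y + 1); last by ring.
by apply; [rewrite (le_trans y1)// lerDl | rewrite subr_ge0 s1 lerBlDr lerDl].
Qed.

Lemma Gamma_gt0 z : 1 <= z -> 0 < Gamma z.
Proof.
have gt0_nat n : 0 < Gamma (n.+1%:R : R).
  elim: n => [|n IH]; first by rewrite Gamma1.
  by rewrite -natr1 GammaS ?ler1n// mulr_gt0.
move=> z1; have [n /andP[n1 nz]] : exists n, (n.+1%:R <= z < n.+2%:R)%R.
  have := truncn_itv (le_trans ler01 z1); case: (Num.truncn z) => [|n] /andP[zn nz].
    by move: nz; rewrite ltNge z1.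
  by exists n; rewrite zn nz.
have := @Gamma_shift_ge n.+1%:R (z - n.+1%:R).
rewrite subrKC ler1n subr_ge0 n1/= lerBlDr addrC natr1 (ltW nz) => /(_ isT isT).
move=> /(lt_le_trans (mulr_gt0 (ltr0Sn _ _) (gt0_nat n))).
by rewrite pmulr_rgt0// powR_gt0// (lt_le_trans ltr01).
Qed.

End GammaFunction.

(** * The reciprocal central binomial through an infinite product *)

Section CentralBinomial.
Variable R : realType.
Implicit Types (a b y : R).
Local Opaque Gamma.

(* The bounds come from Bernoulli's inequality [t ^ s <= 1 - s + s * t] under the
   integral defining Gamma. *)
Lemma Gamma_log_convex_bounds y a : 1 <= y -> 0 <= a <= 2^-1 ->
  (1 - 2 * a / y) * (Gamma y * Gamma (y + 2 * a)) <= Gamma (y + a) ^+ 2 /\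
  Gamma (y + a) ^+ 2 <= (1 + 2 * a / y) * (Gamma y * Gamma (y + 2 * a)).
Proof.
move=> y1 /andP[a0 a12].
have y0 : 0 < y := lt_le_trans ltr01 y1.
have a01 : 0 <= a <= 1 by rewrite a0/= (le_trans a12)// invf_le1// ler1n.
have b01 : 0 <= 2 * a <= 1 by rewrite mulr_ge0//= -(@ler_pM2l _ 2^-1)// mulKf// mulr1.
have G0 := Gamma_gt0 y1.
have G1 : 0 < Gamma (y + a) by apply: Gamma_gt0; rewrite (le_trans y1)// lerDl.
have G2 : 0 < Gamma (y + 2 * a).
  by apply: Gamma_gt0; rewrite (le_trans y1)// lerDl mulr_ge0.
have U1 := Gamma_shift_le y1 a01; have L1 := Gamma_shift_ge y1 a01.
have U2 := Gamma_shift_le y1 b01; have L2 := Gamma_shift_ge y1 b01.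
have yy b : y `^ b != 0 by rewrite gt_eqF ?powR_gt0.
have sq b : (y `^ b) ^+ 2 = y `^ (2 * b).
  by rewrite -powR_mulrn ?powR_ge0// -powRrM mulrC.
have normalize b (g g' : R) : 0 <= b -> y * g <= (y + b) `^ (1 - b) * g' ->
    y `^ b * g <= (1 + b / y) `^ (1 - b) * g'.
  move=> b0 H; rewrite -(ler_pM2l (powR_gt0 (1 - b) y0)).
  have E1 : y `^ (1 - b) * (y `^ b * g) = y * g.
    rewrite mulrA -powRD ?(gt_eqF y0) ?implybT//.
    by rewrite subrK powRr1// ltW.
  have E2 : y `^ (1 - b) * ((1 + b / y) `^ (1 - b) * g') =
      (y + b) `^ (1 - b) * g'.
    rewrite mulrA -powRM ?(ltW y0)//; last by rewrite addr_ge0 ?divr_ge0// ltW.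
    by rewrite mulrDr mulr1 mulrCA divff ?mulr1// gt_eqF.
  by rewrite E1 E2.
have L1' := normalize _ _ _ a0 L1.
have L2' := normalize _ _ _ (mulr_ge0 (ler0n _ 2) a0) L2.
move: G0 G1 G2 U1 L1' U2 L2' {L1 L2 normalize}.
move: (Gamma y) (Gamma (y + a)) (Gamma (y + 2 * a)) => g0 g1 g2.
move=> /ltW G0 /ltW G1 /ltW G2 U1 L1 U2 L2.
have e0 : 0 <= a / y by rewrite divr_ge0// ltW.
have e20 : 0 <= 2 * a / y by rewrite -mulrA mulr_ge0.
have ya0 := powR_ge0 y a.
split.
  have L1' : y `^ a * g0 <= (1 + a / y) * g1.
    apply: le_trans L1 _; apply: ler_wpM2r => //; apply: ler1_powR.
      by rewrite lerDl.
    by rewrite lerBlDr lerDl.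
  have e1 : 2 * a / y <= 1 by rewrite ler_pdivrMr// mul1r (le_trans _ y1)//; lra.
  have K : (y `^ a * g0) ^+ 2 <= ((1 + a / y) * g1) ^+ 2.
    by apply: lerXn2r; rewrite ?nnegrE// mulr_ge0// addr_ge0.
  have K2 : g0 * g2 <= (1 + a / y) ^+ 2 * g1 ^+ 2.
    rewrite -exprMn; apply: le_trans K; rewrite exprMn sq expr2 mulrA [leRHS]mulrC.
    exact: ler_wpM2l.
  apply: le_trans (ler_wpM2l _ K2) _; first by rewrite subr_ge0.
  rewrite mulrA -[leRHS]mul1r; apply: ler_wpM2r; first exact: sqr_ge0.
  have -> : 2 * a / y = 2 * (a / y) by rewrite mulrA.
  rewrite -subr_ge0 (_ : 1 - _ = 3 * (a / y) ^+ 2 + 2 * (a / y) ^+ 3); last by ring.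
  by rewrite addr_ge0// mulr_ge0// exprn_ge0.
have L2' : y `^ (2 * a) * g0 <= (1 + 2 * a / y) * g2.
  apply: le_trans L2 _; apply: ler_wpM2r => //; apply: ler1_powR.
    by rewrite lerDl.
  by rewrite lerBlDr lerDl mulr_ge0.
have K : g1 ^+ 2 <= (y `^ a * g0) ^+ 2.
  by apply: lerXn2r; rewrite ?nnegrE// mulr_ge0.
apply: le_trans K _; rewrite exprMn sq expr2 mulrA mulrC [leRHS]mulrCA.
exact: ler_wpM2l.
Qed.

Lemma Gamma_ratio_near1 (n : nat) a : `|a| <= 2^-1 ->
  `|Gamma (n.+2%:R + a) ^+ 2 / (Gamma n.+2%:R * Gamma (n.+2%:R + 2 * a)) - 1|
    <= n.+1%:R^-1.
Proof.
have aux (y b : R) : n.+1%:R <= y -> 0 <= b <= 2^-1 ->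
    `|Gamma (y + b) ^+ 2 / (Gamma y * Gamma (y + 2 * b)) - 1| <= n.+1%:R^-1.
  move=> ny b12; have y1 : 1 <= y by rewrite (le_trans _ ny)// ler1n.
  have [L U] := Gamma_log_convex_bounds y1 b12.
  move: b12 => /andP[b0 b12]; have y0 : 0 < y := lt_le_trans ltr01 y1.
  have G0 : 0 < Gamma y * Gamma (y + 2 * b).
    by rewrite mulr_gt0 ?Gamma_gt0// (le_trans y1)// lerDl mulr_ge0.
  rewrite -ler_pdivrMr// in U; rewrite -ler_pdivlMr// in L.
  have near1 (u v r : R) : u <= v -> 1 - u <= r -> r <= 1 + u -> `|r - 1| <= v.
    by clear; move=> ? ? ?; rewrite ler_norml; apply/andP; split; lra.
  apply: near1 L U; rewrite ler_pdivrMr// -ler_pdivrMl ?invr_gt0// invrK.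
  apply: le_trans ny; rewrite -[leRHS]mulr1; apply: ler_wpM2l => //.
  by clear -b12; lra.
move=> an; have [a0|a0] := leP 0 a.
  apply: aux; first by rewrite ler_nat.
  by rewrite a0/= (le_trans (ler_norm _)).
(* For negative [a] the two outer arguments exchange roles: the base point is n + 2 + 2 a, which is
   still at least n + 1, and the step is - a. *)
have := aux (n.+2%:R + 2 * a) (- a); rewrite ltr0_norm// in an.
rewrite (_ : n.+2%:R + 2 * a + - a = n.+2%:R + a); last by ring.
rewrite (_ : n.+2%:R + 2 * a + 2 * - a = n.+2%:R); last by ring.
rewrite [Gamma (_ + 2 * a) * _]mulrC; apply.
  by rewrite -[n.+2%:R]natr1 -addrA lerDl; lra.
by rewrite oppr_ge0 (ltW a0).
Qed.

Definition rising a (n : nat) : R := \prod_(j < n) (j.+1%:R + a).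

Lemma risingS a n : rising a n.+1 = rising a n * (n.+1%:R + a).
Proof. by rewrite /rising big_ord_recr. Qed.

Lemma rising_neq0 a n : -1 < a -> rising a n != 0.
Proof.
move=> a1; elim: n => [|n IH]; first by rewrite /rising big_ord0 oner_eq0.
rewrite risingS mulf_neq0// gt_eqF//.
by rewrite -natr1 -addrA ltr_wpDl//; lra.
Qed.

(** For b > -1 the common quotient is Gamma(1 + b). The offset 2 keeps all arguments of Gamma at
    least 1, where the functional equation is available. *)
Lemma Gamma_rising b (m n : nat) : -1 <= b ->
  Gamma (m.+2%:R + b) * rising b n.+1 = Gamma (n.+2%:R + b) * rising b m.+1.
Proof.
move=> b1.
suff H k : Gamma (k.+2%:R + b) * rising b 1 = Gamma (2 + b) * rising b k.+1.
  have [b1'|b1'] := eqVneq b (- 1).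
    by rewrite b1' /rising !big_ord_recl subrr !mul0r !mulr0.
  have r0 : rising b 1 != 0 by apply: rising_neq0; rewrite lt_neqAle eq_sym b1'.
  by apply: (mulIf r0); rewrite mulrAC H [RHS]mulrAC H; ring.
elim: k => [//|k IH].
rewrite (risingS b k.+1) mulrA -IH -[k.+3%:R]natr1 [X in Gamma X](_ : _ = k.+2%:R + b + 1); last by ring.
rewrite GammaS; last by rewrite -[k.+2%:R]natr1 -addrA ler_wpDr ?ler1n//; lra.
ring.
Qed.

Definition hfac (x : R) : R := (1 + 2 * x) / (1 + x) ^+ 2.

Lemma prod_hfac a n : -1 < a ->
  \prod_(j < n) hfac (a / j.+1%:R) = n`!%:R * rising (2 * a) n / rising a n ^+ 2.
Proof.
move=> a1; elim: n => [|n IH].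
  by rewrite /rising !big_ord0 fact0 expr1n divr1 mulr1.
rewrite big_ord_recr/= IH !risingS factS natrM /hfac.
have r0 := rising_neq0 n a1.
have n0 : n.+1%:R != 0 :> R by rewrite pnatr_eq0.
have na0 : n.+1%:R + a != 0.
  by rewrite gt_eqF// -natr1 -addrA ltr_wpDl//; lra.
move: n0 na0 r0; move: (n.+1%:R : R) (rising a n) (rising (2 * a) n) => N r r2 n0 na0 r0.
by field; rewrite r0 n0 na0.
Qed.

(** The sequence [L] is constant by the functional equation and tends to [Q], so [Q] is its value at
    [k], where the Gamma values of the binomial appear. In effect [Q] is Gamma(1 + a)^2 / Gamma(1 +
    2 a), without evaluating Gamma below 1. *)
Lemma inv_central_binomial (k : nat) a (Q : R) : `|a| < 2^-1 ->
  (fun n => \prod_(j < n) hfac (a / j.+1%:R)) @ \oo --> Q ->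
  (central_binomial (k.+1%:R + a))^-1 =
    Q * rising a k.+1 ^+ 2 / rising (2 * a) (k.+1 + k.+1).
Proof.
move=> a12 HQ.
have am : - (2^-1) < a /\ a < 2^-1 by move: a12; rewrite ltr_norml => /andP[].
have a1 : -1 < a by lra.
have a2 : -1 < 2 * a by lra.
pose L n := Gamma (n.+2%:R + a) ^+ 2 / (Gamma n.+2%:R * Gamma (n.+2%:R + 2 * a)) *
  \prod_(j < n.+1) hfac (a / j.+1%:R).
have Gn n b : -1 < b -> Gamma (n.+2%:R + b) != 0.
  by move=> b1; rewrite gt_eqF// Gamma_gt0//; rewrite -natr1 -addrA ler_wpDr ?ler1n//; lra.
have GnN n : Gamma n.+2%:R = n.+1`!%:R :> R.
  elim: n => [|n IH]; first by rewrite -[2%:R]natr1 GammaS// Gamma1 mulr1.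
  by rewrite -natr1 GammaS ?ler1n// IH -natrM.
have LE n : L n = Gamma (2 + a) ^+ 2 * rising (2 * a) 1 / (Gamma (2 + 2 * a) * rising a 1 ^+ 2).
  rewrite /L prod_hfac// GnN.
  have Ea := Gamma_rising n 0 (ltW a1). have E2a := Gamma_rising n 0 (ltW a2).
  have f0 : n.+1`!%:R != 0 :> R by rewrite pnatr_eq0 -lt0n fact_gt0.
  have ra := rising_neq0 n.+1 a1; have r2a := rising_neq0 n.+1 a2.
  have r1 := rising_neq0 1 a1; have r12 := rising_neq0 1 a2.
  have -> : Gamma (n.+2%:R + a) = Gamma (2 + a) * rising a n.+1 / rising a 1.
    by rewrite -Ea mulfK.
  have -> : Gamma (n.+2%:R + 2 * a) = Gamma (2 + 2 * a) * rising (2 * a) n.+1 / rising (2 * a) 1.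
    by rewrite -E2a mulfK.
  have G2 := Gn 0%N _ a2; field.
  by rewrite G2 f0 ra r2a r1 r12.
have LQ : L @ \oo --> Q.
  rewrite -[Q]mul1r; apply: cvgM; last by rewrite (cvg_shiftS (fun n => \prod_(j < n) hfac (a / j.+1%:R))).
  apply/cvgrPdist_le => e e0; near=> n.
  rewrite distrC (le_trans (Gamma_ratio_near1 n (ltW a12)))//.
  by apply: ltW; near: n; exact: (near_infty_natSinv_lt (PosNum e0)).
have <- : L k = Q.
  have EL : L = fun=> L k by apply/funext => n; rewrite !LE.
  by rewrite EL in LQ; exact: (cvg_unique _ (cvg_cst (L k)) LQ).
rewrite /central_binomial invf_div /L prod_hfac// GnN.
have f0 : k.+1`!%:R != 0 :> R by rewrite pnatr_eq0 -lt0n fact_gt0.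
have ra := rising_neq0 k.+1 a1; have r2a := rising_neq0 k.+1 a2.
have r3a := rising_neq0 (k.+1 + k.+1) a2.
have -> : k.+1%:R + a + 1 = k.+2%:R + a by rewrite -[in RHS]natr1; ring.
have -> : 2 * (k.+1%:R + a) + 1 = (k + k.+1).+2%:R + 2 * a.
  by rewrite -[in RHS]natr1 -addSn natrD; ring.
have E := Gamma_rising (k + k.+1) k (ltW a2).
have -> : Gamma ((k + k.+1).+2%:R + 2 * a) =
    Gamma (k.+2%:R + 2 * a) * rising (2 * a) (k + k.+1).+1 / rising (2 * a) k.+1.
  by rewrite -E mulfK.
rewrite addSn in r3a *.
have G2 := Gn k _ a2; field.
by rewrite G2 f0 ra r2a r3a.
Unshelve. all: by end_near. Qed.

End CentralBinomial.

(** * Convergent power series and the value of the tail product *)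

Section PowerSeries.
Variable R : realType.
Implicit Types (u : fps R) (x r C K a : R).

Lemma is_cvg_pseries_geometric u C K a : (forall e, `|u e| <= C * K ^+ e) ->
  0 <= K -> K * `|a| < 1 -> cvgn (pseries u a).
Proof.
move=> H K0 Ka; apply: normed_cvg.
have C0 : 0 <= C by have := H 0%N; rewrite expr0 mulr1; exact: le_trans.
apply: (@series_le_cvg _ _ (geometric C (K * `|a|))) => [e|e|e|].
- exact: normr_ge0.
- by rewrite /geometric/= mulr_ge0// exprn_ge0// mulr_ge0.
- by rewrite /geometric/= normrM normrX exprMn mulrA ler_wpM2r// exprn_ge0.
- by apply: is_cvg_geometric_series; rewrite ger0_norm// mulr_ge0.
Qed.

Lemma pseries_diffs_le u C K e : (forall e, `|u e| <= C * K ^+ e) -> 0 <= K ->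
  `|pseries_diffs u e| <= (C * K) * (2 * K) ^+ e.
Proof.
move=> H K0; rewrite /pseries_diffs normrM normr_nat.
have E2 : e.+1%:R <= 2 ^+ e :> R by rewrite -natrX ler_nat ltn_expl.
apply: le_trans (ler_pM _ _ E2 (H e.+1)) _ => //.
by rewrite exprMn exprS le_eqVlt; apply/orP; left; apply/eqP; ring.
Qed.

(** Each derivative replaces [K] by 2 K, because e + 1 <= 2^e. One more power of 2 is needed since
    differentiating termwise asks for convergence of the second formal derivative. *)
Lemma jet_pseries x r n u C K : (forall e, `|u e| <= C * K ^+ e) -> 0 <= K ->
  0 < r -> r * (K * 2 ^+ n.+1) < 1 ->
  jet x r n (fun y => limn (pseries u (y - x))) u.
Proof.
have at0 v : limn (pseries v (x - x)) = v 0%N.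
  rewrite subrr; apply: cvg_lim => //; rewrite -cvg_shiftS/=.
  rewrite (_ : (fun N => _) = fun=> v 0%N); first exact: cvg_cst.
  apply/funext => N; rewrite /pseries/series/= big_nat_recl// expr0 mulr1.
  by rewrite big1 ?addr0// => i _; rewrite exprS mul0r mulr0.
elim: n u C K => [|n IH] u C K H K0 r0 rK; split=> //.
exists (fun y => limn (pseries (pseries_diffs u) (y - x))); split; last first.
  apply: (IH _ (C * K) (2 * K)) => //; last first.
  - by move: rK; rewrite exprS; congr (_ < _); ring.
  - by rewrite mulr_ge0.
  - by move=> e; exact: pseries_diffs_le.
move=> y yr.
have H1 e := pseries_diffs_le e H K0.
have K20 : 0 <= 2 * K by rewrite mulr_ge0.
have H2 e := pseries_diffs_le e H1 K20.
have r4 : 2 * (2 * K) * `|r| < 1.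
  apply: le_lt_trans rK; rewrite ger0_norm ?(ltW r0)// mulrC ler_wpM2l ?(ltW r0)//.
  have -> : 2 * (2 * K) = K * 2 ^+ 2 by ring.
  by rewrite ler_wpM2l// ler_weXn2l// ler1n.
have r0' : 0 <= `|r| by [].
have D : is_derive (y - x) 1 (fun z => limn (pseries u z))
    (limn (pseries (pseries_diffs u) (y - x))).
  apply: (@pseries_snd_diffs _ _ r).
  - apply: (is_cvg_pseries_geometric H K0); apply: le_lt_trans r4.
    by rewrite ler_wpM2r// mulrA ler_peMl//; lra.
  - apply: (is_cvg_pseries_geometric H1 K20); apply: le_lt_trans r4.
    by rewrite ler_wpM2r// ler_peMl//; lra.
  - by apply: (is_cvg_pseries_geometric H2) => //; rewrite mulr_ge0.
  - by rewrite [ltRHS]ger0_norm ?(ltW r0).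
have D' : is_derive y 1 (fun z => z - x) 1.
  by apply: is_derive_eq; rewrite subr0.
have := @is_derive1_comp _ (fun z => limn (pseries u z)) (fun z => z - x) y _ _ D D'.
by rewrite mulr1.
Qed.

Lemma pseries_linM (c d : R) u a : cvgn (pseries u a) ->
  pseries (lin c d * u) a @ \oo --> (c + d * a) * limn (pseries u a).
Proof.
move=> cu; rewrite -cvg_shiftS/=.
have pS (v : fps R) N : pseries v a N.+1 = pseries v a N + v N * a ^+ N.
  by rewrite /pseries seriesSr.
have -> : (fun N => pseries (lin c d * u) a N.+1) =
    (fun N => c * pseries u a N.+1 + d * a * pseries u a N).
  apply/funext; elim=> [|N IH].
    by rewrite /pseries !seriesSr /series/= !big_geq// linM0; ring.
  rewrite (pS (lin c d * u) N.+1) IH (pS u N.+1) (pS u N) linMS exprS; ring.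
rewrite mulrDl; apply: cvgD.
  by apply: cvgMr; rewrite (cvg_shiftS (pseries u a)).
exact: cvgMr.
Qed.

Lemma tail_product_pseries_near1 m a : `|a| <= 16^-1 ->
  `|limn (pseries (tail_product R m) a) - 1| <= 2 * wt R m.
Proof.
move=> a16.
have cv : cvgn (pseries (tail_product R m) a).
  apply: (@is_cvg_pseries_geometric _ 1 8) => //; last lra.
  by move=> e; rewrite mul1r tail_product_bound.
have h : (fun N => `|pseries (tail_product R m) a N.+1 - 1|) @ \oo -->
    `|limn (pseries (tail_product R m) a) - 1|.
  apply: cvg_norm; apply: cvgB; last exact: cvg_cst.
  by rewrite (cvg_shiftS (pseries (tail_product R m) a)).
rewrite -(cvg_lim (@Rhausdorff R) h); apply: limr_le; first exact: (cvgP _ h).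
apply: nearW => N.
rewrite /pseries /series/= big_nat_recl// tail_product0 expr0 mulr1 addrAC subrr add0r.
rewrite big_mkord; apply: le_trans (ler_norm_sum _ _ _) _.
have term (i : 'I_N) : `|tail_product R m i.+1 * a ^+ i.+1| <= wt R m * 2^-1 ^+ i.
  have A : `|a| ^+ i.+1 <= 16^-1 ^+ i.+1 by rewrite lerXn2r// nnegrE.
  rewrite normrM normrX; apply: le_trans (ler_pM _ _ (tail_product_le R i m) A) _ => //.
  rewrite mulrAC -exprMn (_ : 8 * 16^-1 = 2^-1); last by field.
  rewrite mulrC ler_wpM2l ?(ltW (wt_gt0 _ _))// exprS ler_piMl// ?exprn_ge0//.
  by lra.
apply: le_trans (ler_sum _ (fun i _ => term i)) _.
rewrite -mulr_sumr mulrC ler_wpM2r ?(ltW (wt_gt0 _ _))//.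
apply: le_trans (geometric_le _ _) _; first by apply/andP; split; lra.
by rewrite -[leRHS]invrK lef_pV2 ?posrE; lra.
Qed.

(** The values [F m] of the formal tail products satisfy the expected one-step relation, so the
    partial product is F 0 / F n, and F n tends to 1. *)
Lemma prod_hfac_cvg a : `|a| <= 16^-1 ->
  (fun n => \prod_(j < n) hfac (a / j.+1%:R)) @ \oo -->
    limn (pseries (tail_product R 0) a).
Proof.
move=> a16; pose F m := limn (pseries (tail_product R m) a).
have cv m : cvgn (pseries (tail_product R m) a).
  apply: (@is_cvg_pseries_geometric _ 1 8) => //; last lra.
  by move=> e; rewrite mul1r tail_product_bound.
have step m : F m = hfac (a / m.+1%:R) * F m.+1.
  have m0 : m.+1%:R != 0 :> R by rewrite pnatr_eq0.
  have cl (c d : R) u : cvgn (pseries u a) -> cvgn (pseries (lin c d * u) a).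
    by move=> cu; apply/cvg_ex; exists ((c + d * a) * limn (pseries u a)); exact: pseries_linM.
  have E := congr1 (fun u => limn (pseries u a)) (tail_product_lin R m).
  rewrite expr2 -mulrA in E.
  rewrite /= in E.
  have ev (c d : R) u : cvgn (pseries u a) ->
      limn (pseries (lin c d * u) a) = (c + d * a) * limn (pseries u a).
    by move=> cu; apply: cvg_lim => //; exact: pseries_linM.
  rewrite (ev _ _ _ (cl _ _ _ (cv m))) (ev _ _ _ (cv m)) (ev _ _ _ (cv m.+1)) in E.
  rewrite -/(F m) -/(F m.+1) in E.
  have n0 : 1 + a / m.+1%:R != 0.
    rewrite gt_eqF// -ltrBlDl sub0r ltrNl; apply: le_lt_trans (ler_norm _) _.
    rewrite normrN normf_div normr_nat; apply: le_lt_trans (_ : `|a| < 1); last lra.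
    by rewrite ler_pdivrMr// ler_peMr// ler1n.
  have E' : (1 + a / m.+1%:R) * ((1 + a / m.+1%:R) * F m) =
      (1 + 2 * (a / m.+1%:R)) * F m.+1.
    by rewrite (mulrC a) E; congr (_ * _); ring.
  move: n0 E'; move: (a / m.+1%:R) (F m) (F m.+1) => X p q n0 E'.
  apply: (mulfI n0); apply: (mulfI n0).
  by rewrite E' /hfac; field.
have prodE n : \prod_(j < n) hfac (a / j.+1%:R) * F n = F 0%N.
  elim: n => [|n IH]; first by rewrite big_ord0 mul1r.
  by rewrite big_ord_recr/= -mulrA -step.
have F1 : F @ \oo --> (1 : R).
  have ub : (fun n => 2 * wt R n) @ \oo --> (0 : R).
    by rewrite -(mulr0 2); apply: cvgMr; exact: wt_cvg0.
  apply/cvgrPdist_le => e e0; near=> n; rewrite distrC.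
  apply: le_trans (tail_product_pseries_near1 n a16) _.
  rewrite -[leLHS]ger0_norm ?mulr_ge0 ?(ltW (wt_gt0 _ _))//.
  by near: n; move/cvgr0Pnorm_le : ub; apply.
have H : (fun n => F 0%N / F n) @ \oo --> F 0%N.
  rewrite -[X in _ --> X]mulr1 -[X in _ * X]invr1; apply: cvgMr.
  by apply: cvgV; rewrite ?oner_eq0.
apply: cvg_trans H; apply: near_eq_cvg; near=> n.
have Fn0 : F n != 0.
  near: n; move/cvgrPdist_lt : F1 => /(_ 1 ltr01); apply: filterS => n.
  by apply: contraTneq => ->; rewrite subr0 normr1 ltxx.
by rewrite -(prodE n) mulfK.
Unshelve. all: by end_near. Qed.

End PowerSeries.

(** * Beta values as series, and their norm at radius 1/16 *)

Section BetaSeries.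
Variable R : realType.
Implicit Types (u v : fps R) (c d s : R).

(** A bound on a weighted l^1 norm, phrased with partial sums so that no convergence has to be
    established first. *)
Definition norm_le s u := forall N, \sum_(i < N) `|u i| * 16^-1 ^+ i <= s.

Lemma norm_le_ge0 s u : norm_le s u -> 0 <= s.
Proof. by move=> /(_ 0%N); rewrite big_ord0. Qed.

Lemma norm_le_trans s t u : s <= t -> norm_le s u -> norm_le t u.
Proof. by move=> st H N; exact: le_trans (H N) st. Qed.

Lemma norm_le_coef s u e : norm_le s u -> `|u e| <= s * 16 ^+ e.
Proof.
move=> /(_ e.+1); rewrite big_ord_recr/= exprVn => H.
rewrite -ler_pdivrMr ?exprn_gt0//; apply: le_trans H.
by rewrite lerDr sumr_ge0// => i _; rewrite mulr_ge0// exprn_ge0.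
Qed.

Lemma norm_le_lin c d s u : 0 <= c -> 0 <= d ->
  norm_le s u -> norm_le ((c + d / 16) * s) (lin c d * u).
Proof.
move=> c0 d0 H.
pose S v N : R := \sum_(i < N) `|v i| * 16^-1 ^+ i.
have SS v N : S v N.+1 = S v N + `|v N| * 16^-1 ^+ N by rewrite /S big_ord_recr.
have P N : S (lin c d * u) N.+1 <= c * S u N.+1 + d / 16 * S u N.
  elim: N => [|N IH].
    by rewrite !SS /S !big_ord0 linM0 normrM (ger0_norm c0) expr0; lra.
  rewrite SS [S u N.+2]SS [in d / 16 * _]SS linMS.
  have X0 : 0 <= 16^-1 ^+ N :> R by rewrite exprn_ge0.
  have A : `|c * u N.+1 + d * u N| <= c * `|u N.+1| + d * `|u N|.
    by apply: le_trans (ler_normD _ _) _; rewrite !normrM (ger0_norm c0) (ger0_norm d0).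
  apply: le_trans (lerD IH (ler_wpM2r _ A)) _; first by rewrite exprn_ge0.
  by rewrite exprS le_eqVlt; apply/orP; left; apply/eqP; ring.
move=> N; apply: (@le_trans _ _ (S (lin c d * u) N.+1)).
  by rewrite SS lerDl mulr_ge0// exprn_ge0.
apply: le_trans (P N) _; rewrite mulrDl.
have d16 : 0 <= d / 16 by rewrite divr_ge0.
exact: lerD (ler_wpM2l c0 (H _)) (ler_wpM2l d16 (H _)).
Qed.

(** For the quotient v one has u = (c + d X) v, hence c |v_(i+1)| <= |u_(i+1)| + d |v_i|; the shift
    of degree turns d into d / 16 in the norm. *)
Lemma norm_le_invlin c d s u : 0 < c -> 0 <= d -> d / 16 < c ->
  norm_le s u -> norm_le (s / (c - d / 16)) (invlin c d * u).
Proof.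
move=> c0 d0 dc H; set v := invlin c d * u.
have uE : u = lin c d * v by rewrite /v mulrA lin_invlin ?mul1r// gt_eqF.
pose S v N : R := \sum_(i < N) `|v i| * 16^-1 ^+ i.
have SS w N : S w N.+1 = S w N + `|w N| * 16^-1 ^+ N by rewrite /S big_ord_recr.
have P N : c * S v N.+1 <= S u N.+1 + d / 16 * S v N.
  elim: N => [|N IH].
    rewrite !SS /S !big_ord0 [in leRHS]uE linM0 normrM (gtr0_norm c0) expr0.
    by rewrite !add0r !mulr1 mulr0 addr0.
  rewrite [S v N.+2]SS [S u N.+2]SS [in d / 16 * _]SS.
  have A : c * `|v N.+1| <= `|u N.+1| + d * `|v N|.
    have -> : c * `|v N.+1| = `|u N.+1 - d * v N|.
      by rewrite [in RHS]uE linMS addrK normrM (gtr0_norm c0).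
    by apply: le_trans (ler_normB _ _) _; rewrite normrM (ger0_norm d0).
  have B : 0 <= 16^-1 ^+ N.+1 :> R by rewrite exprn_ge0.
  have := lerD IH (ler_wpM2r B A); rewrite !exprS => K.
  by apply: le_trans (le_trans _ K) _; rewrite le_eqVlt; apply/orP; left; apply/eqP; ring.
move=> N; rewrite ler_pdivlMr ?subr_gt0//.
have mono : S v N <= S v N.+1 by rewrite SS lerDl mulr_ge0// exprn_ge0.
have := P N; have := H N.+1; rewrite -/(S u N.+1) -/(S v N) => H1 H2.
have d16 : 0 <= d / 16 by rewrite divr_ge0.
have c00 := ltW c0.
have K1 := ler_wpM2l c00 mono.
by rewrite mulrBr mulrC [S v N * _]mulrC; lra.
Qed.

Lemma norm_le_tail_product : norm_le 2 (tail_product R 0).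
Proof.
move=> N.
have term (i : 'I_N) : `|tail_product R 0 i| * 16^-1 ^+ i <= 2^-1 ^+ i.
  have -> : 2^-1 ^+ i = 8 ^+ i * 16^-1 ^+ i :> R.
    by rewrite -exprMn; congr (_ ^+ _); field.
  by rewrite ler_wpM2r ?exprn_ge0// tail_product_bound.
apply: le_trans (ler_sum _ (fun i _ => term i)) _.
apply: le_trans (geometric_le _ _) _; first by apply/andP; split; lra.
by rewrite -[leRHS]invrK lef_pV2 ?posrE; lra.
Qed.

(* The series in [a] of [B(m + 1 + a, k + 1 + a)]. *)
Definition beta_series (m k : nat) : fps R :=
  tail_product R 0 * \prod_(j < m) lin j.+1%:R 1 * \prod_(j < k) lin j.+1%:R 1 *
  \prod_(j < (m + k).+1) invlin j.+1%:R 2.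

Lemma beta_series_recl m k :
  beta_series m.+1 k = lin m.+1%:R 1 * invlin (m + k).+2%:R 2 * beta_series m k.
Proof.
rewrite /beta_series addSn big_ord_recr/= [\prod_(j < (m + k).+2) _]big_ord_recr/=.
by ring.
Qed.

Lemma beta_series_recr m k :
  beta_series m k.+1 = lin k.+1%:R 1 * invlin (m + k).+2%:R 2 * beta_series m k.
Proof.
rewrite /beta_series addnS [\prod_(j < k.+1) _]big_ord_recr/=.
rewrite [\prod_(j < (m + k).+2) _]big_ord_recr/=.
by ring.
Qed.

Lemma beta_series_swap m k :
  lin k.+1%:R 1 * beta_series m.+1 k = lin m.+1%:R 1 * beta_series m k.+1.
Proof. by rewrite beta_series_recl beta_series_recr; ring. Qed.

Lemma beta_series_add m k :
  beta_series m k = beta_series m k.+1 + beta_series m.+1 k.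
Proof.
rewrite beta_series_recl beta_series_recr -!mulrA -mulrDl linD mulrA.
have -> : k.+1%:R + m.+1%:R = (m + k).+2%:R :> R.
  by rewrite -natrD; congr (_%:R); lia.
by rewrite lin_invlin ?mul1r ?pnatr_eq0.
Qed.

Definition beta_bound (m : nat) : R := 4 * wt R m.+1.

(** Raising k multiplies the norm by at most (k + 1 + 1/16) / (m + k + 2 - 1/8) <= 1. For k = 0 and
    M = m + 2, raising m multiplies it by at most 1 - (13/16) / (M - 1/8), which is below sqrt(M /
    (M + 1)), about 1 - (1/2) / M. *)
Lemma norm_le_beta_series m k : norm_le (beta_bound m) (beta_series m k).
Proof.
have n0 n : 0 < n.+1%:R :> R by rewrite ltr0n.
have aux (i n : nat) : (i <= n)%N -> 2 / 16 < n.+2%:R :> R.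
  move=> _; apply: lt_le_trans (_ : 1 <= _); first by lra.
  by rewrite ler1n.
elim: k => [|k IH]; last first.
  rewrite beta_series_recr mulrC mulrA [_ * lin _ _]mulrC -mulrA [beta_series _ _ * _]mulrC.
  have b0 := norm_le_ge0 IH.
  have := norm_le_lin (ltW (n0 k)) ler01 (norm_le_invlin (ltr0Sn _ _) (ler0n _ 2) (aux 0%N (m + k)%N isT) IH).
  apply: norm_le_trans.
  rewrite mulrC -mulrA -[leRHS]mulr1 ler_wpM2l// mulrC ler_pdivrMr ?mul1r.
    rewrite -[(m + k).+2%:R]natr1 -addnS natrD.
    by have : 0 <= m%:R :> R by []; lra.
  by rewrite subr_gt0 (aux 0%N).
elim: m => [|m IH].
  have -> : beta_series 0 0 = invlin 1 2 * tail_product R 0.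
    by rewrite /beta_series !big_ord0 big_ord1/=; ring.
  have h : 2 / 16 < 1 :> R by lra.
  have := norm_le_invlin ltr01 (ler0n _ 2) h norm_le_tail_product.
  apply: norm_le_trans; rewrite /beta_bound /wt.
  have s0 : 0 < Num.sqrt 2 :> R by rewrite sqrtr_gt0.
  have s2 : Num.sqrt 2 <= 3 / 2 :> R.
    rewrite -[leRHS]ger0_norm// -sqrtr_sqr ler_sqrt ?sqr_ge0//.
    by rewrite expr2; lra.
  (* The starting norm 16/7 must be below 4 / sqrt 2, which the constant 4 of [beta_bound]
     ensures. *)
  rewrite ler_pdivlMr// (_ : 2 / (1 - 2 / 16) = 16 / 7 :> R); last by field.
  by move: s2; move: (Num.sqrt 2) => z; lra.
rewrite beta_series_recl addn0 -mulrA.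
have := norm_le_lin (ltW (n0 m)) ler01 (norm_le_invlin (ltr0Sn _ _) (ler0n _ 2) (aux 0%N m isT) IH).
apply: norm_le_trans; rewrite /beta_bound /wt.
have x0 : 0 < Num.sqrt m.+2%:R :> R by rewrite sqrtr_gt0 ltr0n.
have y0 : 0 < Num.sqrt m.+3%:R :> R by rewrite sqrtr_gt0 ltr0n.
have xx : Num.sqrt m.+2%:R ^+ 2 = m.+2%:R :> R by rewrite sqr_sqrtr ?ler0n.
have yy : Num.sqrt m.+3%:R ^+ 2 = m.+2%:R + 1 :> R.
  by rewrite natr1 sqr_sqrtr ?ler0n.
have M1 : 1 <= m.+2%:R :> R by rewrite ler1n.
have -> : m.+1%:R = m.+2%:R - 1 :> R by rewrite -[m.+2%:R]natr1 addrK.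
move: x0 y0 xx yy M1.
move: (Num.sqrt m.+2%:R) (Num.sqrt m.+3%:R) => x y.
move: (m.+2%:R) => M x0 y0 xx yy M1.
have d0 : 0 < M - 2 / 16 by lra.
have key : (M - 15 / 16) * y <= (M - 1 / 8) * x.
  have n1 : 0 <= M - 15 / 16 by lra.
  have n2 : 0 <= M - 1 / 8 by lra.
  rewrite -ler_sqr ?nnegrE ?mulr_ge0 ?(ltW x0) ?(ltW y0)//.
  rewrite !exprMn xx yy -subr_ge0.
  have -> : (M - 1 / 8) ^+ 2 * M - (M - 15 / 16) ^+ 2 * (M + 1) =
    5 / 8 * (M * (M - 1)) + (M - 1) * (419 / 256) + (194 / 256) by field.
  have M0 : 0 <= M by lra.
  have M1' : 0 <= M - 1 by lra.
  by have := mulr_ge0 M0 M1'; lra.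
have q0 : 0 < M - 1 / 8 by lra.
rewrite ler_pdivlMr//.
have -> : (M - 1 + 1 / 16) * (4 / x / (M - 2 / 16)) * y =
    4 * (((M - 15 / 16) * y) / ((M - 1 / 8) * x)).
  by field; rewrite (gt_eqF x0)/=; apply/andP; split; rewrite gt_eqF//; lra.
rewrite -[leRHS]mulr1 ler_wpM2l//.
by rewrite ler_pdivrMr ?mulr_gt0// [leRHS]mul1r.
Qed.

End BetaSeries.

(** * The operators I_s and the telescoping identity *)

Section Telescoping.
Variable R : realType.
Implicit Types (F G psi : nat -> fps R) (C : nat -> R) (c : fps R).

Definition shift_inv (m : nat) : fps R := invlin m%:R 1.

Lemma shift_invK m : shift_inv m.+1 * lin m.+1%:R 1 = 1.
Proof. by rewrite mulrC lin_invlin// pnatr_eq0. Qed.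

Lemma shift_invX_coef s m e : (shift_inv m.+1 ^+ s) e =
  (shift_inv 1 ^+ s) e / m.+1%:R ^+ (e + s).
Proof.
have [q Eq] := homogeneousX s (@homogeneous_invlin R).
by rewrite /shift_inv !Eq muln1 expr1n divr1.
Qed.

(* The operator I_s, coefficient by coefficient. *)
Definition tail_op (s : nat) F (m : nat) : fps R :=
  fun e => tail (fun m' => (shift_inv m' ^+ s * F m') e) m.

Definition bounded_by C F := forall m e, `|F m.+1 e| <= C e * wt R m.+1.

Definition tail_op_const (s : nat) C (e : nat) : R :=
  \sum_(i < e.+1) `|(shift_inv 1 ^+ s) i| * C (e - i)%N.

Lemma bounded_dominated s C F e : (0 < s)%N -> bounded_by C F ->
  dominated (tail_op_const s C e) (fun m' => (shift_inv m' ^+ s * F m') e).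
Proof.
move=> s0 H m; rewrite fpsM; apply: le_trans (ler_norm_sum _ _ _) _.
rewrite mulr_suml; apply: ler_sum => i _.
rewrite shift_invX_coef normrM normf_div normrX normr_nat -mulrA.
have A : (m.+1%:R ^+ (i + s))^-1 <= m.+1%:R^-1 :> R.
  rewrite lef_pV2 ?posrE ?exprn_gt0// -[leLHS]expr1 ler_weXn2l ?ler1n//.
  by rewrite (leq_trans s0)// leq_addl.
have X0 : 0 <= (m.+1%:R ^+ (i + s))^-1 :> R by rewrite invr_ge0 exprn_ge0.
have -> : `|(shift_inv 1 ^+ s) i| * C (e - i)%N * (wt R m.+1 / m.+1%:R) =
    `|(shift_inv 1 ^+ s) i| * (m.+1%:R^-1 * (C (e - i)%N * wt R m.+1)) by ring.
by apply: ler_wpM2l => //; apply: ler_pM => //; exact: H.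
Qed.

Lemma tail_op_le s C F m e : (0 < s)%N -> bounded_by C F ->
  `|tail_op s F m e| <= 4 * tail_op_const s C e * wt R m.
Proof. by move=> s0 H; exact: (tail_le (bounded_dominated e s0 H)). Qed.

Lemma tail_op_bounded s C F : (0 < s)%N -> bounded_by C F ->
  bounded_by (fun e => 4 * tail_op_const s C e) (tail_op s F).
Proof. by move=> s0 H m e; exact: tail_op_le. Qed.

Lemma tail_op_rec s C F m : (0 < s)%N -> bounded_by C F ->
  tail_op s F m = shift_inv m.+1 ^+ s * F m.+1 + tail_op s F m.+1.
Proof.
move=> s0 H; apply/funext => e.
by rewrite fpsD [LHS](tail_rec (bounded_dominated e s0 H)).
Qed.

Lemma tail_op_cvg0 s C F e : (0 < s)%N -> bounded_by C F ->
  (fun m => tail_op s F m e) @ \oo --> 0.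
Proof. by move=> s0 H; exact: (tail_cvg0 (bounded_dominated e s0 H)). Qed.

Lemma tail_op_unique s F psi :
  (forall m, psi m = shift_inv m.+1 ^+ s * F m.+1 + psi m.+1) ->
  (forall e, (fun m => psi m e) @ \oo --> 0) -> tail_op s F = psi.
Proof.
move=> H p0; apply/funext => m; apply/funext => e.
apply: (@tail_telescope _ _ (fun m => psi m e)) => // k.
by rewrite [in LHS]H fpsD addrK.
Qed.

Lemma cvg0_mul c psi : (forall e, (fun m => psi m e) @ \oo --> 0) ->
  forall e, (fun m => (c * psi m) e) @ \oo --> 0.
Proof.
move=> H e; under eq_fun do rewrite fpsM.
apply: cvg_sum0 => i _; rewrite -(mulr0 (c i)); apply: cvgMr; exact: H.
Qed.

Lemma cvg0_add F G : (forall e, (fun m => F m e) @ \oo --> 0) ->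
  (forall e, (fun m => G m e) @ \oo --> 0) ->
  forall e, (fun m => (F m + G m) e) @ \oo --> 0.
Proof.
by move=> HF HG e; have := cvgD (HF e) (HG e); rewrite addr0; exact.
Qed.

Lemma tail_op_lin s C C' F G c : (0 < s)%N -> bounded_by C F -> bounded_by C' G ->
  tail_op s (fun m => F m + c * G m) = (fun m => tail_op s F m + c * tail_op s G m).
Proof.
move=> s0 HF HG; apply: tail_op_unique => [m|].
  by rewrite (tail_op_rec _ s0 HF) (tail_op_rec _ s0 HG); ring.
apply: cvg0_add => [e|]; first exact: tail_op_cvg0 s0 HF.
by apply: cvg0_mul => e; exact: tail_op_cvg0 s0 HG.
Qed.

(* [beta_row k m] stands for [B(m + a, k + 1 + a)]; the value at [m = 0] is junk
   that no tail involves. *)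
Definition beta_row (k m : nat) : fps R :=
  if m is m'.+1 then beta_series R m' k else 0.

Definition beta_const (e : nat) : R := 4 * 16 ^+ e.

Lemma beta_row_bounded k : bounded_by beta_const (beta_row k).
Proof.
move=> m e; apply: le_trans (norm_le_coef e (norm_le_beta_series R m k)) _.
by rewrite /beta_bound /beta_const mulrAC.
Qed.

Definition telescoper (k : nat) : fps R :=
  tail_op 2 (tail_op 1 (beta_row k)) k - 2 * tail_op 1 (tail_op 2 (beta_row k)) k +
  2 * tail_op 3 (beta_row k) k +
  2 * tail_op 1 (tail_op 1 (tail_op 1 (beta_row k))) k.

Section Step.
Variable k : nat.
Let b := beta_row k.+1.
Let b' := beta_row k.
Let xi := shift_inv k.+1.
(** [T] stands for I_0 b, a case outside the estimates for [tail_op], which require a positive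
    exponent. [T_rec] shows that it is a sum of values of [b], and [T_succ] gives it in closed
    form. *)
Let T (m : nat) := beta_series R m k.

Let Hb : bounded_by beta_const b := @beta_row_bounded k.+1.
Let Hb' : bounded_by beta_const b' := @beta_row_bounded k.

Let T_bounded : bounded_by beta_const T.
Proof.
move=> m e; apply: le_trans (norm_le_coef e (norm_le_beta_series R m.+1 k)) _.
rewrite /beta_bound /beta_const mulrAC ler_wpM2l ?mulr_ge0 ?exprn_ge0//.
exact: wt_le.
Qed.

Let T_cvg0 e : (fun m => T m e) @ \oo --> 0.
Proof.
have ub : (fun m => beta_const e * wt R m) @ \oo --> 0.
  by rewrite -(mulr0 (beta_const e)); apply: cvgMr; exact: wt_cvg0.
rewrite -cvg_shiftS; apply: norm_cvg0; apply: (squeeze_cvgr _ (cvg_cst 0)); last first.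
  by rewrite -cvg_shiftS in ub; exact: ub.
by near=> m; rewrite normr_ge0/= T_bounded.
Unshelve. all: by end_near. Qed.

Let T_rec m : T m = b m.+1 + T m.+1.
Proof. exact: beta_series_add. Qed.

Let T_succ m : T m.+1 = xi * (lin m.+1%:R 1 * b m.+1).
Proof.
by rewrite -[in RHS]beta_series_swap mulrA shift_invK mul1r.
Qed.

Let b'E m : b' m.+1 = b m.+1 + xi * (lin m.+1%:R 1 * b m.+1).
Proof. by rewrite -T_succ -T_rec. Qed.

Let shift_invS s m c : shift_inv m.+1 ^+ s.+1 * (xi * (lin m.+1%:R 1 * c)) =
  xi * (shift_inv m.+1 ^+ s * c).
Proof.
rewrite exprSr -[RHS]mul1r -(shift_invK m); ring.
Qed.

Let I1b' : tail_op 1 b' = fun m => tail_op 1 b m + xi * T m.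
Proof.
apply: tail_op_unique => [m|]; last first.
  by apply: cvg0_add => [e|]; [exact: tail_op_cvg0 Hb|exact: cvg0_mul].
rewrite (tail_op_rec m _ Hb)// [T m]T_rec b'E !mulrDr shift_invS expr0 mul1r.
by ring.
Qed.

Let ISb' s : (0 < s)%N ->
  tail_op s.+1 b' = fun m => tail_op s.+1 b m + xi * tail_op s b m.
Proof.
move=> s0; apply: tail_op_unique => [m|]; last first.
  apply: cvg0_add => [e|]; first exact: tail_op_cvg0 Hb.
  by apply: cvg0_mul => e; exact: tail_op_cvg0 Hb.
rewrite (tail_op_rec m _ Hb)// [tail_op s b m](tail_op_rec m _ Hb)//.
by rewrite b'E !mulrDr shift_invS; ring.
Qed.

(** By [T_succ], dividing [T] by p gives back xi b, so I_1 T is xi I_0 b, that is xi T; [I2T] has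
    the same reason. *)
Let I1T : tail_op 1 T = fun m => xi * T m.
Proof.
apply: tail_op_unique => [m|]; last exact: cvg0_mul.
rewrite [in LHS]T_rec mulrDr; congr (_ + _).
by rewrite T_succ shift_invS expr0 mul1r.
Qed.

Let I2T : tail_op 2 T = fun m => xi * tail_op 1 b m.
Proof.
apply: tail_op_unique => [m|]; last first.
  by apply: cvg0_mul => e; exact: tail_op_cvg0 Hb.
rewrite [in LHS](tail_op_rec m _ Hb)// mulrDr; congr (_ + _).
by rewrite T_succ shift_invS.
Qed.

(** Each operator on b' is expanded by splitting off the term k + 1, where 1/p is xi, and by the
    relations above. With coefficients A, B, C, D for I_2 I_1, I_1 I_2, I_3, I_1 I_1 I_1, the terms
    in I_1 b, I_2 b and I_1 I_1 b vanish when 2 A + B = B + C = B + D = 0. This forces the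
    proportions 1, -2, 2, 2, and xi^3 b is left with A + 2 C + 2 D = 9. *)
Lemma telescoper_step :
  telescoper k = 9 * (xi ^+ 3 * b k.+1) + telescoper k.+1.
Proof.
have H1 := tail_op_bounded (isT : 0 < 1)%N Hb.
have H2 := tail_op_bounded (isT : 0 < 2)%N Hb.
have H11 := tail_op_bounded (isT : 0 < 1)%N H1.
have H1' := tail_op_bounded (isT : 0 < 1)%N Hb'.
have H2' := tail_op_bounded (isT : 0 < 2)%N Hb'.
have H11' := tail_op_bounded (isT : 0 < 1)%N H1'.
have I21 : tail_op 2 (tail_op 1 b') =
    fun m => tail_op 2 (tail_op 1 b) m + xi * (xi * tail_op 1 b m).
  by rewrite I1b' (tail_op_lin _ _ H1 T_bounded)// I2T.
have I12 : tail_op 1 (tail_op 2 b') =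
    fun m => tail_op 1 (tail_op 2 b) m + xi * tail_op 1 (tail_op 1 b) m.
  by rewrite ISb'// (tail_op_lin _ _ H2 H1).
have I11 : tail_op 1 (tail_op 1 b') =
    fun m => tail_op 1 (tail_op 1 b) m + xi * (xi * T m).
  by rewrite I1b' (tail_op_lin _ _ H1 T_bounded)// I1T.
have I111 : tail_op 1 (tail_op 1 (tail_op 1 b')) =
    fun m => tail_op 1 (tail_op 1 (tail_op 1 b)) m + xi * xi * (xi * T m).
  rewrite I11.
  have -> : (fun m => tail_op 1 (tail_op 1 b) m + xi * (xi * T m)) =
     (fun m => tail_op 1 (tail_op 1 b) m + (xi * xi) * T m).
    by apply/funext => m; rewrite mulrA.
  by rewrite (tail_op_lin _ _ H11 T_bounded)// I1T.
have Tk : T k.+1 = b k.+1.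
  by rewrite T_succ mulrA shift_invK mul1r.
rewrite /telescoper -/b -/b'.
rewrite (tail_op_rec k _ H1')// (tail_op_rec k _ H2')// (tail_op_rec k _ Hb')//.
rewrite (tail_op_rec k _ H11')// I111 I12 I21 I11 (@ISb' 1%N)// (@ISb' 2%N)// I1b' b'E -T_succ Tk -/xi.
by ring.
Qed.

End Step.

(** Row and evaluation point move together, so the bounds have to be uniform in the row:
    [beta_const] does not depend on k. *)
Lemma telescoper_cvg0 e : (fun k => telescoper k e) @ \oo --> 0.
Proof.
have cv s C (F : nat -> nat -> fps R) (c : fps R) : (0 < s)%N ->
    (forall k, bounded_by C (F k)) ->
    forall e, (fun k => (c * tail_op s (F k) k) e) @ \oo --> 0.
  move=> s0 H; apply: cvg0_mul => {}e; apply: norm_cvg0.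
  have ub : (fun k => 4 * tail_op_const s C e * wt R k) @ \oo --> 0.
    by rewrite -(mulr0 (4 * tail_op_const s C e)); apply: cvgMr; exact: wt_cvg0.
  apply: (squeeze_cvgr _ (cvg_cst 0) ub).
  by near=> k; rewrite normr_ge0/= tail_op_le.
have H1 k := tail_op_bounded (isT : 0 < 1)%N (@beta_row_bounded k).
have H2 k := tail_op_bounded (isT : 0 < 2)%N (@beta_row_bounded k).
have H11 k := tail_op_bounded (isT : 0 < 1)%N (H1 k).
have E k : telescoper k = 1 * tail_op 2 (tail_op 1 (beta_row k)) k +
    (- 2) * tail_op 1 (tail_op 2 (beta_row k)) k + 2 * tail_op 3 (beta_row k) k +
    2 * tail_op 1 (tail_op 1 (tail_op 1 (beta_row k))) k.
  by rewrite /telescoper mul1r mulNr.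
under eq_fun do rewrite E; move: e.
apply: cvg0_add; last by move=> e; exact: (cv 1%N _ _ 2 isT H11).
apply: cvg0_add; last by move=> e; exact: (cv 3%N _ _ 2 isT beta_row_bounded).
apply: cvg0_add; first by move=> e; exact: (cv 2%N _ _ 1 isT H1).
by move=> e; exact: (cv 1%N _ _ (- 2) isT H2).
Unshelve. all: by end_near. Qed.

End Telescoping.

(** * Multiple zeta values from D_0, and derivatives of the summands *)

Section Evaluation.
Variable R : realType.

(* Multiplying by [inv_rising m] removes the factors with index [j <= m], which
   are not tails, from [B(m + a, 1 + a)]. *)
Definition inv_rising (m : nat) : fps R := \prod_(j < m) lin 1 (j.+1%:R^-1).

Let g (m : nat) : R := Num.sqrt (wt R m).

(** The norm of [inv_rising m] grows at most like m^(1/16). Bounding it by 1 / g, that is (m +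
    1)^(1/4), leaves a decay of [g] against [wt]. *)
Let g_gt0 m : 0 < g m. Proof. by rewrite sqrtr_gt0 wt_gt0. Qed.

Let gg m : g m ^+ 2 = wt R m. Proof. by rewrite sqr_sqrtr// ltW// wt_gt0. Qed.

Let g_step m : (1 + m.+1%:R^-1 / 16) * g m.+1 <= g m.
Proof.
set x : R := m.+1%:R^-1.
have m0 : 0 < m.+1%:R :> R by rewrite ltr0n.
have x0 : 0 <= x by rewrite invr_ge0.
have x1 : x <= 1 by rewrite invf_le1// ler1n.
have c0 : 0 <= 1 + x / 16 by lra.
have xx : x ^+ 2 <= x by rewrite expr2 ler_piMl.
have xx0 : 0 <= x ^+ 2 by rewrite sqr_ge0.
have step (u v c d : R) : 0 <= c -> c ^+ 2 <= d -> 0 <= u -> d * u <= v ->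
    c * Num.sqrt u <= Num.sqrt v.
  move=> cp cd u0 duv; rewrite -[c]ger0_norm// -sqrtr_sqr -sqrtrM ?sqr_ge0//.
  by rewrite ler_wsqrtr// (le_trans _ duv)// ler_wpM2r.
(* Two square roots are taken in turn: (1 + x/16)^2 <= 1 + x/4 and (1 + x/4)^2 <= 1 + x, where (1 +
   x)(m + 1) = m + 2. *)
apply: (step _ _ _ (1 + x / 4)) => //.
- have -> : (1 + x / 16) ^+ 2 = 1 + x / 8 + x ^+ 2 / 256 by field.
  lra.
- exact: ltW (wt_gt0 _ _).
have key : (1 + x / 4) * Num.sqrt m.+1%:R <= Num.sqrt m.+2%:R.
  apply: (step _ _ _ (1 + x)) => //; first by lra.
  - have -> : (1 + x / 4) ^+ 2 = 1 + x / 2 + x ^+ 2 / 16 by field.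
    lra.
  - by rewrite mulrDl mul1r /x mulVf ?natr1// gt_eqF.
by rewrite /wt ler_pdivrMr ?sqrtr_gt0 ?ltr0n// [leRHS]mulrC ler_pdivlMr ?sqrtr_gt0.
Qed.

Lemma norm_le_inv_rising m : norm_le (g m)^-1 (inv_rising m).
Proof.
elim: m => [|m IH].
  rewrite /inv_rising big_ord0 /g /wt sqrtr1 invr1 sqrtr1 invr1 => -[|N].
    by rewrite big_ord0.
  rewrite big_ord_recl fps1 normr1 expr0 mulr1 big1 ?addr0// => i _.
  by rewrite fps1 normr0 mul0r.
rewrite /inv_rising big_ord_recr/= mulrC.
have x0 : 0 <= m.+1%:R^-1 :> R by rewrite invr_ge0.
apply: norm_le_trans (norm_le_lin ler01 x0 IH).
by rewrite ler_pdivrMr// [leRHS]mulrC ler_pdivlMr// g_step.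
Qed.

Lemma inv_rising_cvg0 (psi : nat -> fps R) :
  (forall e, exists C, forall m, `|psi m e| <= C * wt R m) ->
  forall e, (fun m => (inv_rising m * psi m) e) @ \oo --> 0.
Proof.
move=> H e; under eq_fun do rewrite fpsM.
apply: cvg_sum0 => i _; have [C HC] := H (e - i)%N; apply: norm_cvg0.
have ub : (fun m => 16 ^+ i * C * g m) @ \oo --> 0.
  rewrite -(mulr0 (16 ^+ i * C)); apply: cvgMr.
  rewrite -(@sqrtr0 R); apply: continuous_cvg; first exact: sqrt_continuous.
  exact: wt_cvg0.
apply: (squeeze_cvgr _ (cvg_cst 0) ub); near=> m; rewrite normr_ge0/= normrM.
apply: le_trans (ler_pM _ _ (norm_le_coef i (norm_le_inv_rising m)) (HC m)) _ => //.
rewrite -gg le_eqVlt; apply/orP; left; apply/eqP; field.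
by rewrite gt_eqF.
Unshelve. all: by end_near. Qed.

Lemma inv_rising_beta m :
  inv_rising m.+1 * beta_row R 0 m.+1 = shift_inv R m.+1 * tail_product R m.+1.
Proof.
have X n : inv_rising n * tail_product R 0 * \prod_(j < n) lin j.+1%:R 1 *
    \prod_(j < n) invlin j.+1%:R 2 = tail_product R n.
  elim: n => [|n IH]; first by rewrite /inv_rising !big_ord0 mul1r !mulr1.
  have n0 : n.+1%:R != 0 :> R by rewrite pnatr_eq0.
  rewrite /inv_rising !big_ord_recr/= -/(inv_rising n).
  transitivity (lin 1 n.+1%:R^-1 * lin n.+1%:R 1 * invlin n.+1%:R 2 * tail_product R n).
    by rewrite -[in RHS]IH; ring.
  have E1 : lin n.+1%:R 1 = lin n.+1%:R 0 * lin 1 n.+1%:R^-1 :> fps R.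
    by rewrite linZ mulr1 mulfV.
  have E2 : lin n.+1%:R 2 = lin n.+1%:R 0 * lin 1 (2 / n.+1%:R) :> fps R.
    by rewrite linZ mulr1 mulrCA mulfV ?mulr1.
  transitivity (invlin n.+1%:R 2 * (lin n.+1%:R 0 *
      (lin 1 n.+1%:R^-1 ^+ 2 * tail_product R n))); first by rewrite E1; ring.
  rewrite tail_product_lin [lin _ 0 * _]mulrA -E2 mulrA [invlin _ _ * _]mulrC.
  by rewrite lin_invlin// mul1r.
rewrite -[in RHS](X m.+1) /beta_row /beta_series big_ord0 addn0 mulr1.
rewrite [\prod_(j < m.+1) lin _ _]big_ord_recr/=.
rewrite -[LHS]mul1r -(shift_invK R m) /shift_inv; ring.
Qed.

(** The factor 1 + X / m.+1 is the quotient of [inv_rising m.+1] by [inv_rising m], so the recursion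
    of [tail_op] becomes the one treated by [graded_rec]. *)
Lemma graded_tail_op s b d C (F : nat -> fps R) v chi : (0 < s)%N -> (1 < s + b + d)%N ->
  bounded_by C F -> homogeneous b v -> graded d chi ->
  (forall m, inv_rising m.+1 * F m.+1 = v m * chi m.+1) ->
  graded (s + b + d)%N (fun m => inv_rising m * tail_op s F m).
Proof.
move=> s0 sbd bF hv gchi E.
have hu : homogeneous (s + b) (fun m => shift_inv R m.+1 ^+ s * v m).
  apply: homogeneousM hv.
  by have := homogeneousX s (@homogeneous_invlin R); rewrite muln1.
apply: (graded_rec _ _ hu gchi) => //; first by rewrite addn_gt0 s0.
  move=> m; rewrite -mulrA -E (tail_op_rec m s0 bF) /inv_rising.
  by rewrite big_ord_recr/=; ring.
apply: inv_rising_cvg0 => e; exists (4 * tail_op_const s C e) => m.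
exact: tail_op_le.
Qed.

(** The Beta product enters only in the innermost operator, through [inv_rising_beta], and accounts
    for weight 1; after that each I_s just adds s to the weight. *)
Lemma telescoper_span e : tail_span (e + 4)%N (fun m => (inv_rising m *
  (tail_op 2 (tail_op 1 (beta_row R 0)) m - 2 * tail_op 1 (tail_op 2 (beta_row R 0)) m +
  2 * tail_op 3 (beta_row R 0) m +
  2 * tail_op 1 (tail_op 1 (tail_op 1 (beta_row R 0))) m)) e).
Proof.
set b := beta_row R 0.
have Hb : bounded_by (beta_const R) b := @beta_row_bounded R 0.
have H1 := tail_op_bounded (isT : 0 < 1)%N Hb.
have H2 := tail_op_bounded (isT : 0 < 2)%N Hb.
have H11 := tail_op_bounded (isT : 0 < 1)%N H1.
have gt := @tail_product_graded R; have hs := @homogeneous_invlin R.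
have h1 := @homogeneous1 R.
have E1 (F : nat -> fps R) m : inv_rising m.+1 * F m.+1 = 1 * (inv_rising m.+1 * F m.+1).
  by rewrite mul1r.
have G1 := graded_tail_op (isT : 0 < 1)%N (isT : 1 < 1 + 1 + 0)%N Hb hs gt inv_rising_beta.
have G2 := graded_tail_op (isT : 0 < 2)%N (isT : 1 < 2 + 1 + 0)%N Hb hs gt inv_rising_beta.
have G3 := graded_tail_op (isT : 0 < 3)%N (isT : 1 < 3 + 1 + 0)%N Hb hs gt inv_rising_beta.
have G21 := graded_tail_op (isT : 0 < 2)%N (isT : 1 < 2 + 0 + 2)%N H1 h1 G1 (E1 _).
have G12 := graded_tail_op (isT : 0 < 1)%N (isT : 1 < 1 + 0 + 3)%N H2 h1 G2 (E1 _).
have G11 := graded_tail_op (isT : 0 < 1)%N (isT : 1 < 1 + 0 + 2)%N H1 h1 G1 (E1 _).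
have G111 := graded_tail_op (isT : 0 < 1)%N (isT : 1 < 1 + 0 + 3)%N H11 h1 G11 (E1 _).
apply: rat_span_ext (rat_spanD (rat_spanD (rat_spanD (G21 e)
  (rat_spanZ (- 2%:R) (G12 e))) (rat_spanZ 2%:R (G3 e))) (rat_spanZ 2%:R (G111 e))) => m.
move: (inv_rising m) (tail_op 2 _ m) (tail_op 1 (tail_op 2 b) m) (tail_op 3 b m)
  (tail_op 1 (tail_op 1 (tail_op 1 b)) m) => i A B C D.
have -> : i * (A - 2 * B + 2 * C + 2 * D) = i * A - i * B *+ 2 + i * C *+ 2 + i * D *+ 2.
  by ring.
rewrite !fpsD fpsN !fpsMn rmorphN !rmorph_nat mulNr.
by rewrite !(mulr_natl _ 2).
Qed.

Lemma mzv_telescoper e : mzv_span (e + 4)%N (telescoper R 0 e).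
Proof.
have := mzv_span_tail _ (telescoper_span e).
rewrite /inv_rising big_ord0 mul1r; apply.
by rewrite addnS.
Qed.

Lemma mzv_spanZ (q : rat) w (x : R) : mzv_span w x -> mzv_span w (ratr q * x).
Proof.
move=> [c [Pc ->]]; exists [seq (q * p.1, p.2) | p <- c].
split=> [_ /mapP[p /Pc pc ->]//|].
by rewrite big_map mulr_sumr; apply: eq_bigr => p _; rewrite rmorphM mulrA.
Qed.

(** Near k + 1 the summand is an explicit product of linear factors, their inverses and one power
    series, so no derivative of Gamma is taken. *)
Lemma binom_summand_jet (k n : nat) : exists r, 0 < r /\
  exists f, (forall y, `|y - k.+1%:R| < r -> f y = binom_summand 4 y) /\
  jet (k.+1%:R : R) r n f (shift_inv R k.+1 ^+ 3 * beta_row R k.+1 k.+1).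
Proof.
set x : R := k.+1%:R.
(* The coefficients of the tail product are bounded by 8^e, so this radius gives r * (8 * 2^(n+1)) =
   1/2 in [jet_pseries], and it stays within the 1/16 of [prod_hfac_cvg]. *)
pose r : R := (16 * 2 ^+ n.+1)^-1.
have p2 : 0 < 2 ^+ n.+1 :> R by rewrite exprn_gt0.
have r0 : 0 < r by rewrite invr_gt0 mulr_gt0.
have r16 : r <= 16^-1.
  by rewrite lef_pV2 ?posrE ?mulr_gt0// ler_peMr// exprn_ege1// ler1n.
exists r; split=> //.
pose rise c m (y : R) : R := \prod_(j < m) (j.+1%:R + c * (y - x)).
pose irise c m (y : R) : R := \prod_(j < m) (j.+1%:R + c * (y - x))^-1.
exists (fun y => (x + 1 * (y - x))^-1 ^+ 4 * limn (pseries (tail_product R 0) (y - x)) *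
  rise 1 k.+1 y ^+ 2 * irise 2 (k.+1 + k.+1)%N y).
have pos (j : nat) (c y : R) : 0 <= c <= 2 -> `|y - x| < r -> 0 < j.+1%:R + c * (y - x).
  move=> /andP[c0 c2] yr.
  have : `|c * (y - x)| <= 2 * 16^-1.
    by rewrite normrM (ger0_norm c0) ler_pM// (le_trans (ltW yr)).
  rewrite ler_norml => /andP[L _].
  have j1 : 1 <= j.+1%:R :> R by rewrite ler1n.
  by apply: lt_le_trans (_ : 1 - 2 * 16^-1 <= _); lra.
split.
  move=> y yr; rewrite /binom_summand invfM.
  have y16 : `|y - x| <= 16^-1 by rewrite (le_trans (ltW yr)).
  have yE : y = k.+1%:R + (y - x) by rewrite subrKC.
  rewrite [in central_binomial _]yE (inv_central_binomial _ _ (prod_hfac_cvg y16)); last first.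
    by apply: le_lt_trans y16 _; rewrite ltf_pV2 ?posrE// ltr_nat.
  have e1 : rise 1 k.+1 y = rising (y - x) k.+1.
    by apply: eq_bigr => j _; rewrite mul1r.
  have e2 : irise 2 (k.+1 + k.+1)%N y = (rising (2 * (y - x)) (k.+1 + k.+1))^-1.
    by rewrite /irise prodfV.
  by rewrite e1 e2 mul1r subrKC exprVn -!mulrA.
have jl c j : jet x r n (fun y => j.+1%:R + c * (y - x)) (lin j.+1%:R c) := jet_lin x r n _ c.
have jv c j : 0 <= c <= 2 ->
    jet x r n (fun y => (j.+1%:R + c * (y - x))^-1) (invlin j.+1%:R c).
  move=> c2; apply: (jetV _ r0 _ (jl c j)).
    by move=> y yr; rewrite gt_eqF// pos.
  by rewrite lin_invlin// pnatr_eq0.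
(* The Beta value has k and k + 1 linear factors; the fourth [shift_inv] compensates the factor that
   completes the square. *)
have -> : shift_inv R k.+1 ^+ 3 * beta_row R k.+1 k.+1 =
    shift_inv R k.+1 ^+ 4 * tail_product R 0 * (\prod_(j < k.+1) lin j.+1%:R 1) ^+ 2 *
    \prod_(j < k.+1 + k.+1) invlin j.+1%:R 2.
  rewrite /beta_row /beta_series addnS -addSn addSnnS.
  rewrite [in RHS]big_ord_recr/= [\prod_(j < k.+1) lin _ _]big_ord_recr/=.
  rewrite -[LHS]mul1r -(shift_invK R k); ring.
have c1 : 0 <= (1 : R) <= 2 by apply/andP; split; lra.
have c2 : 0 <= (2 : R) <= 2 by apply/andP; split; lra.
apply: jetM; last exact: (@jet_prod _ _ _ _ (fun j y => (j.+1%:R + 2 * (y - x))^-1)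
  (fun j => invlin j.+1%:R 2) _ (fun j => jv 2 j c2)).
apply: jetM; last first.
  apply: jetX; exact: (@jet_prod _ _ _ _ (fun j y => j.+1%:R + 1 * (y - x))
    (fun j => lin j.+1%:R 1) _ (fun j => jl 1 j)).
apply: jetM; first by apply: jetX; exact: jv.
apply: (@jet_pseries _ x r n _ 1 8) => //.
  by move=> e; rewrite mul1r tail_product_bound.
rewrite /r invfM mulrACA [_^-1 * 2 ^+ _]mulVf ?gt_eqF//; lra.
Qed.

Lemma derive1n_binom_summand (k n : nat) :
  derive1n n (binom_summand 4) (k.+1%:R : R) =
  n`!%:R * (shift_inv R k.+1 ^+ 3 * beta_row R k.+1 k.+1) n.
Proof.
have [r [r0 [f [fE J]]]] := binom_summand_jet k n.
rewrite -(jet_derive1n r0 J); symmetry.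
by apply: (eq_derive1n n r0 fE); rewrite subrr normr0.
Qed.

End Evaluation.

Lemma mzv_inv_binom_sum4 (R : realType) (n : nat) :
  mzv_span (n + 4)%N (inv_binom_sum R 4 n).
Proof.
pose D k := n`!%:R / 9 * telescoper R k n.
have -> : inv_binom_sum R 4 n = D 0%N.
  rewrite /inv_binom_sum.
  apply: (@tail_telescope _ (fun m => derive1n n (binom_summand 4) (m%:R : R)) D 0).
    move=> k; rewrite derive1n_binom_summand /D telescoper_step -mulrBr fpsD addrK.
    by rewrite (mulr_natl _ 9) fpsMn -mulr_natl; field.
  rewrite -(mulr0 (n`!%:R / 9)); apply: cvgMr; exact: telescoper_cvg0.
have -> : D 0%N = ratr (n`!%:R / 9%:R) * telescoper R 0 n.
  by rewrite /D rmorphM fmorphV !rmorph_nat.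
exact/mzv_spanZ/mzv_telescoper.
Qed.

Local Close Scope ring_scope.
Local Close Scope classical_set_scope.

Theorem theorem1p3 (R : realType) (n : nat) :
  mzv_span (n + 4) (inv_binom_sum R 4 n).
Proof.
exact: mzv_inv_binom_sum4.
Qed.
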